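(* Let $q$ be a positive even integer, let $A,B,C$ be complex vector spaces of dimension $q+1$ with bases $a_0,\dots,a_q$, $b_0,\dots,b_q$, $c_0,\dots,c_q$, and let $$T_{skewcw,q}=\sum_{j=1}^q\left(a_0\otimes b_j\otimes c_j+a_j\otimes b_0\otimes c_j\right)+\sum_{\xi=1}^{q/2}\left(a_\xi\otimes b_{\xi+q/2}-a_{\xi+q/2}\otimes b_\xi\right)\otimes c_0.$$ Then for all positive integers $k$, $$\omega\le \log_q\!\left(\frac{4}{27}\,\underline{\mathbf{R}}(T_{skewcw,q}^{\boxtimes k})^{3/k}\right).$$
   Context: $\omega$ denotes the exponent of matrix multiplication: the infimum of $\tau$ such that two $n\times n$ complex matrices can be multiplied using $O(n^\tau)$ arithmetic operations. The border rank $\underline{\mathbf{R}}(T)$ of a tensor $T$ is the smallest $r$ such that $T$ is a limit of a sequence of sums of $r$ tensors of the form $a\otimes b\otimes c$. The Kronecker power $T^{\boxtimes k}\in A^{\otimes k}\otimes B^{\otimes k}\otimes C^{\otimes k}$ is $T^{\otimes k}$ regarded as a 3-way tensor. *)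

(* Defs.v *)
From HB Require Import structures.
From mathcomp Require Import all_boot all_order all_algebra.
From mathcomp Require Import complex.
From mathcomp Require Import all_classical all_reals all_analysis.

Set Implicit Arguments.
Unset Strict Implicit.
Unset Printing Implicit Defensive.

Import Order.TTheory GRing.Theory Num.Theory.
Import numFieldNormedType.Exports.

Local Open Scope classical_set_scope.
Local Open Scope ring_scope.

(* Vectors and 3-way tensors are given by their coordinates: [{ffun I -> K}] is
   the K-vector space with basis indexed by [I], and [tensor3 K I J L] is the
   tensor product of the spaces with bases indexed by [I], [J], [L]. *)
Notation tensor3 K I J L := {ffun I * J * L -> K}.

Section Tensors.
Variable K : fieldType.

Definition outer3 (I J L : finType)
    (a : {ffun I -> K}) (b : {ffun J -> K}) (c : {ffun L -> K}) :
    tensor3 K I J L :=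
  [ffun x : I * J * L => a x.1.1 * b x.1.2 * c x.2].

Definition basis_vec (n j : nat) : {ffun 'I_n -> K} :=
  [ffun i : 'I_n => (i == j :> nat)%:R].

(* The space A^{(x)k} has the basis of the tensors a_{i 0} (x) ... (x) a_{i (k-1)},
   which is indexed by the functions i : 'I_k -> I. *)
Definition kron_pow (I J L : finType) (T : tensor3 K I J L) (k : nat) :
    tensor3 K {ffun 'I_k -> I} {ffun 'I_k -> J} {ffun 'I_k -> L} :=
  [ffun x : {ffun 'I_k -> I} * {ffun 'I_k -> J} * {ffun 'I_k -> L} =>
     \prod_(s < k) T (x.1.1 s, x.1.2 s, x.2 s)].

Definition sum_of_outer3 (I J L : finType) (r : nat) (T : tensor3 K I J L) :
    Prop :=
  exists (a : 'I_r -> {ffun I -> K}) (b : 'I_r -> {ffun J -> K})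
         (c : 'I_r -> {ffun L -> K}),
    T = \sum_(m < r) outer3 (a m) (b m) (c m).

Lemma sum_of_outer3_card (I J L : finType) (T : tensor3 K I J L) :
  sum_of_outer3 #|{: I * J * L}| T.
Proof.
pose x (m : 'I_#|{: I * J * L}|) : I * J * L := enum_val m.
exists (fun m => [ffun i => T (x m) * (i == (x m).1.1)%:R]).
exists (fun m => [ffun j => (j == (x m).1.2)%:R]).
exists (fun m => [ffun l => (l == (x m).2)%:R]).
apply/ffunP => y; rewrite sum_ffunE (bigD1 (enum_rank y)) //= big1 => [|m ne_m].
  by rewrite addr0 !ffunE /x enum_rankK !eqxx !mulr1.
rewrite !ffunE; have : y != x m.
  by apply: contraNneq ne_m => ->; rewrite /x enum_valK.
case: y (x m) {ne_m} => [[i j] l] [[i' j'] l'] /=; rewrite !xpair_eqE.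
by do 3! case: eqP => _ //=; rewrite ?mulr0 ?mul0r.
Qed.

End Tensors.

Section BorderRank.
Variable R : realType.

(* The limit is taken coordinatewise, which is the topology of a
   finite-dimensional complex vector space. *)
Definition limit_of_sums (I J L : finType) (T : tensor3 R[i] I J L) (r : nat) :
    Prop :=
  exists S : nat -> tensor3 R[i] I J L,
    (forall n, sum_of_outer3 r (S n)) /\
    (forall x, (fun n => S n x : R[i]^o) @ \oo --> (T x : R[i]^o)).

Lemma limit_of_sums_exists (I J L : finType) (T : tensor3 R[i] I J L) :
  exists r, `[< limit_of_sums T r >].
Proof.
exists #|{: I * J * L}|; apply/asboolP; exists (fun=> T); split => [n|x].
  exact: sum_of_outer3_card.
exact: cvg_cst.
Qed.

Definition border_rank (I J L : finType) (T : tensor3 R[i] I J L) : nat :=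
  ex_minn (limit_of_sums_exists T).

End BorderRank.

(* A straight-line program is a list of arithmetic instructions; the m-th
   instruction produces the m-th result, and the operands of an instruction are
   inputs, constants or earlier results. *)
Inductive arith_op := Add | Sub | Mul | Div.

Inductive operand (X K : Type) :=
  | Input of X
  | Const of K
  | Result of nat.

Arguments Input {X K}.
Arguments Const {X K}.
Arguments Result {X K}.

Record instr (X K : Type) := Instr {
  instr_op : arith_op;
  instr_lhs : operand X K;
  instr_rhs : operand X K
}.

Section StraightLinePrograms.
Variables (X : Type) (K : fieldType).

(* Evaluation fails, with value [None], on a division by zero and on a
   reference to a result that has not been computed yet. *)
Definition eval_op (o : arith_op) (u v : K) : option K :=
  match o with
  | Add => Some (u + v)
  | Sub => Some (u - v)
  | Mul => Some (u * v)
  | Div => if v == 0 then None else Some (u / v)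
  end.

Definition eval_operand (x : X -> K) (res : seq K) (o : operand X K) :
    option K :=
  match o with
  | Input i => Some (x i)
  | Const a => Some a
  | Result m => onth res m
  end.

Definition eval_instr (x : X -> K) (res : seq K) (c : instr X K) : option K :=
  match eval_operand x res (instr_lhs c), eval_operand x res (instr_rhs c) with
  | Some u, Some v => eval_op (instr_op c) u v
  | _, _ => None
  end.

Fixpoint run (x : X -> K) (res : seq K) (p : seq (instr X K)) :
    option (seq K) :=
  match p with
  | [::] => Some res
  | c :: p' =>
      match eval_instr x res c with
      | Some v => run x (rcons res v) p'
      | None => None
      end
  end.

End StraightLinePrograms.

Section Omega.
Variable R : realType.

Definition mx_entries (n : nat) : Type := ('I_n * 'I_n + 'I_n * 'I_n)%type.

Definition mx_input (n : nat) (A B : 'M[R[i]]_n) (x : mx_entries n) : R[i] :=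
  match x with
  | inl ij => A ij.1 ij.2
  | inr ij => B ij.1 ij.2
  end.

Definition multiplies (n : nat) (p : seq (instr (mx_entries n) R[i]))
    (out : 'I_n -> 'I_n -> operand (mx_entries n) R[i]) : Prop :=
  forall A B : 'M[R[i]]_n,
    exists2 res, run (mx_input A B) [::] p = Some res &
      forall i j, eval_operand (mx_input A B) res (out i j)
                  = Some ((A *m B) i j).

Definition matmul_in (n s : nat) : Prop :=
  exists (p : seq (instr (mx_entries n) R[i]))
         (out : 'I_n -> 'I_n -> operand (mx_entries n) R[i]),
    size p = s /\ multiplies p out.

Definition matmul_exponents : set R :=
  [set tau | exists c : R, \forall n \near \oo,
     exists2 s : nat, matmul_in n s & s%:R <= c * n%:R `^ tau].

Definition omega : R := inf matmul_exponents.

End Omega.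

Definition skewcw (K : fieldType) (q : nat) :
    tensor3 K 'I_q.+1 'I_q.+1 'I_q.+1 :=
  let e := basis_vec K q.+1 in
  \sum_(1 <= j < q.+1)
     (outer3 (e 0%N) (e j) (e j) + outer3 (e j) (e 0%N) (e j))
  + \sum_(1 <= xi < (q %/ 2).+1)
     (outer3 (e xi) (e (xi + q %/ 2)%N) (e 0%N)
      - outer3 (e (xi + q %/ 2)%N) (e xi) (e 0%N)).

Definition logb (R : realType) (b x : R) : R := ln x / ln b.

(* Main.v *)
Require Import Defs.
From mathcomp Require Import all_boot all_order all_algebra.
From mathcomp Require Import complex.
From mathcomp Require Import all_classical all_reals all_analysis.
From mathcomp Require Import zify ring lra.

Set Implicit Arguments.
Unset Strict Implicit.
Unset Printing Implicit Defensive.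

Import Order.TTheory GRing.Theory Num.Theory.
Import numFieldNormedType.Exports.

Local Open Scope ring_scope.

(* Laser method.  If T is a limit of tensors S_n of rank at most r, then the
   M-th power of T lies in the span of the M-th powers of the S_n, a space of
   dimension polynomial in M, so its rank is at most r^M up to a polynomial
   factor.  This replaces the algebraic description of border rank.

   The support of T_skewcw consists of three blocks, indexed by which of the
   three factors has its index 0.  In the 3N-th power the balanced blocks
   correspond to the partitions of the positions into three sets of size N, and
   each is a matrix multiplication tensor of format q^N x q^N x q^N; the signs
   and the matching xi <-> xi + q/2 disappear after a change of basis inside
   the block.  A random linear hash b of the sets selects the partitions
   (I, J, K) with b(I) + w = b(J) + const, and a first moment argument leaves
   binomial(3N, N) / O(N) of them that share no set with another selected one.
   Scaling the three bases by powers of a parameter e produces the total factor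
   e^((b(I) + w - b(J) - const)^2), so that only the selected blocks survive as
   e -> 0: a direct sum of (27/4)^(N - o(N)) matrix multiplications is a limit of
   tensors whose rank is bounded by that of the 3N-th power.  Multiplying
   matrices recursively by means of this direct sum bounds omega. *)

(** * Rank of tensors *)

Section Rank.
Variable K : fieldType.

(** Coordinates range over arbitrary types, so that powers can be indexed by plain functions and
    tensors pulled back along any maps. *)
Definition rank_le (X Y Z : Type) (r : nat) (T : X -> Y -> Z -> K) : Prop :=
  exists (a : 'I_r -> X -> K) (b : 'I_r -> Y -> K) (c : 'I_r -> Z -> K),
    forall x y z, T x y z = \sum_(m < r) a m x * b m y * c m z.

Lemma rank_le_fin (X Y Z : Type) (G : finType) (a : G -> X -> K)
    (b : G -> Y -> K) (c : G -> Z -> K) (T : X -> Y -> Z -> K) :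
  (forall x y z, T x y z = \sum_m a m x * b m y * c m z) -> rank_le #|G| T.
Proof.
move=> hT; exists (a \o enum_val), (b \o enum_val), (c \o enum_val) => x y z.
by rewrite hT (big_enum_val (fun m => a m x * b m y * c m z)).
Qed.

Lemma rank_leW (X Y Z : Type) (r r' : nat) (T : X -> Y -> Z -> K) :
  (r <= r')%N -> rank_le r T -> rank_le r' T.
Proof.
move=> le_r [a [b [c hT]]]; rewrite -(subnKC le_r) -[(r + _)%N]card_ord.
pose ext U (f : 'I_r -> U -> K) (m : 'I_(r + (r' - r))) u :=
  if fintype.split m is inl m' then f m' u else 0 : K.
apply: (rank_le_fin (a := ext _ a) (b := ext _ b) (c := ext _ c)) => x y z.
rewrite big_split_ord /= hT [X in _ + X]big1 ?addr0 => [|m _].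
  by apply: eq_bigr => m _; rewrite /ext -[lshift _ m]/(unsplit (inl m)) unsplitK.
by rewrite /ext -[rshift _ m]/(unsplit (inr m)) unsplitK !mul0r.
Qed.

(** Scaling and reindexing act on each rank-one term separately. Restriction to blocks and
    degeneration by powers of a parameter both have this form. *)
Lemma rank_le_map (X Y Z X' Y' Z' : Type) (r : nat) (T : X -> Y -> Z -> K)
    (f : X' -> X) (g : Y' -> Y) (h : Z' -> Z)
    (u : X' -> K) (v : Y' -> K) (w : Z' -> K) :
  rank_le r T ->
  rank_le r (fun x y z => u x * v y * w z * T (f x) (g y) (h z)).
Proof.
case=> a [b [c hT]].
exists (fun m x => u x * a m (f x)), (fun m y => v y * b m (g y)).
exists (fun m z => w z * c m (h z)) => x y z.
rewrite hT mulr_sumr; apply: eq_bigr => m _.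
by rewrite mulrACA [u x * _ * _]mulrACA.
Qed.

Lemma rank_le_sum (X Y Z : Type) (d r : nat) (T : 'I_d -> X -> Y -> Z -> K)
    (u : 'I_d -> K) :
  (forall l, rank_le r (T l)) ->
  rank_le (d * r) (fun x y z => \sum_l u l * T l x y z).
Proof.
move=> /choice[a] /choice[b] /choice[c] hT.
have <- : #|{: 'I_d * 'I_r}| = (d * r)%N by rewrite card_prod !card_ord.
apply: (rank_le_fin (a := fun m x => u m.1 * a m.1 m.2 x)
  (b := fun m => b m.1 m.2) (c := fun m => c m.1 m.2)) => x y z.
under eq_bigr => l _ do rewrite hT mulr_sumr.
rewrite pair_big /=; apply: eq_bigr => m _; by rewrite !mulrA.
Qed.

Definition tensor_pow (X Y Z : Type) (P : finType) (T : X -> Y -> Z -> K)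
    (x : P -> X) (y : P -> Y) (z : P -> Z) : K :=
  \prod_s T (x s) (y s) (z s).

Lemma rank_le_pow (X Y Z : Type) (P : finType) (r : nat)
    (T : X -> Y -> Z -> K) :
  rank_le r T -> rank_le (r ^ #|P|) (tensor_pow (P := P) T).
Proof.
case=> a [b [c hT]]; have <- : #|{ffun P -> 'I_r}| = (r ^ #|P|)%N by rewrite card_ffun card_ord.
apply: (rank_le_fin (a := fun (m : {ffun P -> 'I_r}) x => \prod_s a (m s) (x s))
  (b := fun (m : {ffun P -> 'I_r}) y => \prod_s b (m s) (y s))
  (c := fun (m : {ffun P -> 'I_r}) z => \prod_s c (m s) (z s))) => x y z.
rewrite /tensor_pow; under eq_bigr => s _ do rewrite hT.
rewrite bigA_distr_bigA; apply: eq_bigr => m _; by rewrite !big_split.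
Qed.

(* The direct sum, over [t : F], of the tensors sum_(i, j, k) x_ij y_jk z_ki,
   whose coordinates are indexed by (t, i, j), (t, j, k), (t, k, i). *)
Definition mm_sum (F I : finType) (x y z : F * I * I) : K :=
  ([&& x.1.1 == z.1.1, y.1.1 == z.1.1, x.2 == y.1.2, y.2 == z.1.2
    & x.1.2 == z.2])%:R.

(* Flattening the tensor along its first factor gives a matrix with an identity
   submatrix of size [#|F| * #|I| ^ 2]. *)
Lemma rank_mm_sum_ge (F I : finType) (r : nat) :
  (0 < #|I|)%N -> rank_le r (@mm_sum F I) -> (#|F| * #|I| ^ 2 <= r)%N.
Proof.
move=> /card_gt0P[i0 _] [a [b [c hT]]].
pose X : finType := (F * I * I)%type.
have -> : (#|F| * #|I| ^ 2 = #|X|)%N by rewrite !card_prod mulnA.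
pose A : 'M[K]_(#|X|, r) := \matrix_(x, m) a m (enum_val x).
pose B : 'M[K]_(r, #|X|) := \matrix_(m, x)
  let: (t, i, j) := (enum_val x : X) in b m (t, j, i0) * c m (t, i0, i).
suff AB1 : A *m B = 1%:M.
  by rewrite -(mxrank1 K #|X|) -AB1 (leq_trans (mxrankM_maxr _ _)) ?rank_leq_row.
apply/matrixP => x x'; rewrite !mxE.
have -> : (x == x') = (enum_val x == enum_val x' :> X).
  by rewrite (inj_eq enum_val_inj).
under eq_bigr => m _ do rewrite !mxE.
case: (enum_val x) (enum_val x') => [[t i] j] [[t' i'] j'] /=.
under eq_bigr => m _ do rewrite mulrA.
rewrite -hT /mm_sum /= !eqxx !xpair_eqE /= -!andbA.
by case: (t == t'); case: (j == j'); case: (i == i').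
Qed.

Lemma prodr_bool (P : finType) (b : pred P) :
  \prod_s (b s)%:R = [forall s, b s]%:R :> K.
Proof.
case: forallP => [hb|nb]; first by rewrite big1 // => s _; rewrite hb.
have [s /negPf bs] : exists s, ~~ b s.
  by apply/existsP; apply: contra_notT nb => /existsPn h s; exact: negbNE (h s).
by rewrite (bigD1 s) //= bs mul0r.
Qed.

Lemma eq_ffun_forall (P : finType) (V : eqType) (f g : {ffun P -> V}) :
  (f == g) = [forall s, f s == g s].
Proof.
apply/eqP/forallP => [-> s //|fg]; by apply/ffunP => s; apply/eqP.
Qed.

(** The index equalities behind [mm_sum] hold for functions on [P] exactly when they hold at each
    position, so a power of a direct sum of matrix multiplications is again one. *)
Lemma mm_sum_pow (F I P : finType) (r : nat) :
  rank_le r (tensor_pow (P := P) (@mm_sum F I)) ->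
  rank_le r (@mm_sum {ffun P -> F} {ffun P -> I}).
Proof.
pose f (x : {ffun P -> F} * {ffun P -> I} * {ffun P -> I}) s :=
  (x.1.1 s, x.1.2 s, x.2 s).
move=> /(rank_le_map f f f (fun=> 1) (fun=> 1) (fun=> 1)).
case=> a [b [c hT]]; exists a, b, c => x y z; rewrite -hT !mul1r {hT a b c}.
rewrite /tensor_pow /mm_sum /= prodr_bool !eq_ffun_forall; congr ((nat_of_bool _)%:R).
apply/idP/forallP => [/and5P[/forallP h1 /forallP h2 /forallP h3 /forallP h4
  /forallP h5] s|h]; first by rewrite h1 h2 h3 h4 h5.
by apply/and5P; split; apply/forallP => s; case/and5P: (h s).
Qed.

End Rank.

(** * From rank to the complexity of matrix multiplication *)

Section Computation.
Local Open Scope classical_set_scope.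
Variables (D : Type) (K : fieldType).
Implicit Types (S V G H : set (D -> K)) (f g h : D -> K).

(* Straight-line programs up to the names of their instructions: an instruction
   adds a function of the input to the set of the functions computed so far. *)
Inductive computes S : nat -> set (D -> K) -> Prop :=
  | computes0 : computes S 0 S
  | computesS n V o f g h : computes S n V -> V f -> V g ->
      (forall d, eval_op o (f d) (g d) = Some (h d)) ->
      computes S n.+1 (V `|` [set h]).

Definition derivable_in S (s : nat) G : Prop :=
  exists n V, [/\ (n <= s)%N, computes S n V & G `<=` V].

Definition constants : set (D -> K) := [set f | exists a, f = fun=> a].

Lemma computes_sub S n V : computes S n V -> S `<=` V.
Proof. by elim=> // {}n {}V o f g h _ sub _ _ _ x /sub; left. Qed.

Lemma computes_trans S n V m W :
  computes S n V -> computes V m W -> computes S (n + m) W.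
Proof.
move=> cV; elim=> [|{}m {}W o f g h _ cW Wf Wg eh]; first by rewrite addn0.
by rewrite addnS; apply: (computesS cW Wf Wg eh).
Qed.

Lemma computes_mono S S' n V : S `<=` S' -> computes S n V ->
  exists2 V', computes S' n V' & V `<=` V'.
Proof.
move=> sub; elim=> [|{}n {}V o f g h _ [V' cV' sV] Vf Vg eh].
  by exists S' => //; exact: computes0.
exists (V' `|` [set h]); first exact: (computesS cV' (sV _ Vf) (sV _ Vg) eh).
by move=> x [/sV|->]; [left | right].
Qed.

Lemma derivable_inW S S' s s' G G' :
  S `<=` S' -> (s <= s')%N -> G' `<=` G -> derivable_in S s G ->
  derivable_in S' s' G'.
Proof.
move=> sS ss sG [n [V [ns cV GV]]]; have [V' cV' sV] := computes_mono sS cV.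
exists n, V'; split=> //; first exact: leq_trans ss.
by move=> x /sG /GV /sV.
Qed.

Lemma derivable_in0 S G : G `<=` S -> derivable_in S 0 G.
Proof. by move=> sG; exists 0%N, S; split=> //; exact: computes0. Qed.

Lemma derivable_in_trans S s G s' H :
  derivable_in S s G -> derivable_in (S `|` G) s' H ->
  derivable_in S (s + s') (G `|` H).
Proof.
move=> [n [V [ns cV GV]]] [m [W [ms cW HW]]].
have sub : S `|` G `<=` V by move=> x [/(computes_sub cV)|/GV].
have [W' cW' sW] := computes_mono sub cW.
exists (n + m)%N, W'; split; [exact: leq_add | exact: computes_trans cW' |].
by move=> x [/GV/(computes_sub cW')|/HW/sW].
Qed.

Lemma derivable_in_op S s s' f g h o :
  derivable_in S s [set f] -> derivable_in S s' [set g] ->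
  (forall d, eval_op o (f d) (g d) = Some (h d)) ->
  derivable_in S (s + s' + 1) [set h].
Proof.
move=> df dg eh.
have {}dg : derivable_in (S `|` [set f]) s' [set g].
  by apply: derivable_inW dg => // x; left.
have [n [V [ns cV FV]]] := derivable_in_trans df dg.
exists n.+1, (V `|` [set h]); split; first by rewrite addn1 ltnS.
  by apply: (computesS cV _ _ eh); apply: FV; [left | right].
by move=> x; right.
Qed.

Lemma derivable_in_bigcup S s (J : finType) (G : J -> set (D -> K)) :
  (forall j, derivable_in S s (G j)) ->
  derivable_in S (#|J| * s) [set f | exists j, G j f].
Proof.
move=> dG; suff dseq (js : seq J) :
    derivable_in S (size js * s) [set f | exists2 j, j \in js & G j f].
  rewrite cardE; apply: derivable_inW (dseq (enum J)) => // f [j Gj].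
  by exists j; rewrite ?mem_enum.
elim: js => [|j js IH]; first by apply: derivable_in0 => f [].
have dj : derivable_in (S `|` [set f | exists2 j, j \in js & G j f]) s (G j).
  by apply: derivable_inW (dG j) => // x; left.
apply: derivable_inW (derivable_in_trans IH dj) => //.
  by rewrite mulSn addnC.
move=> f [j0]; rewrite inE => /orP[/eqP ->|jjs] Gf; first by right.
by left; exists j0.
Qed.

Lemma derivable_in_linear S (J : finType) (c : J -> K) (f : J -> D -> K) :
  constants `<=` S -> (forall j, S (f j)) ->
  derivable_in S (2 * #|J|) [set fun d => \sum_j c j * f j d].
Proof.
move=> Sc Sf; suff dseq (js : seq J) :
    derivable_in S (2 * size js) [set fun d => \sum_(j <- js) c j * f j d].
  rewrite cardE; apply: derivable_inW (dseq (enum J)) => // g -> /=.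
  by apply/funext => d; rewrite big_enum.
elim: js => [|j js IH].
  apply: derivable_in0 => g ->; apply: Sc; exists 0; apply/funext => d.
  by rewrite big_nil.
have dj : derivable_in S (0 + 0 + 1) [set fun d => c j * f j d].
  apply: (@derivable_in_op _ _ _ (fun=> c j) (f j) _ Mul) => //.
    by apply: derivable_in0 => g ->; apply: Sc; exists (c j).
  by apply: derivable_in0 => g ->.
have -> : (2 * size (j :: js) = 0 + 0 + 1 + 2 * size js + 1)%N.
  by rewrite /= mulnS; lia.
apply: (derivable_in_op (o := Add) dj IH) => d.
by rewrite big_cons.
Qed.

(** The entries are arbitrary functions already available, not just inputs, so that a bound applies
    recursively to linear combinations of blocks. *)
Definition matmul_cost (F I : finType) (c : nat) : Prop :=
  forall S (A B : F -> I -> I -> D -> K), constants `<=` S ->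
    (forall t i j, S (A t i j)) -> (forall t i j, S (B t i j)) ->
    derivable_in S c
      [set f | exists t i k, f = fun d => \sum_j A t i j d * B t j k d].

Lemma matmul_cost_unit (F : finType) : matmul_cost F unit #|F|.
Proof.
move=> S A B Sc SA SB; rewrite -[#|F|]muln1.
have d1 t : derivable_in S 1 [set fun d => A t tt tt d * B t tt tt d].
  apply: (@derivable_in_op S 0 0 (A t tt tt) (B t tt tt) _ Mul) => //;
  by apply: derivable_in0 => g ->.
apply: derivable_inW (derivable_in_bigcup d1) => // f [t [[] [[] ->]]].
exists t => /=; apply/funext => d.
by rewrite (big_pred1 tt) //; case.
Qed.

Lemma sum_delta (J : finType) (j0 : J) (f : J -> K) :
  \sum_j (j == j0)%:R * f j = f j0.
Proof.
rewrite (bigD1 j0) //= eqxx mul1r big1 ?addr0 // => j /negPf ->.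
by rewrite mul0r.
Qed.

Lemma mm_sum_contract (F I : finType) (t : F) (i k : I)
    (f : F * I * I -> F * I * I -> K) :
  \sum_p \sum_p' mm_sum K p p' (t, k, i) * f p p' =
  \sum_j f (t, i, j) (t, j, k).
Proof.
have mmE p p' : mm_sum K p p' (t, k, i) =
    \sum_j (p == (t, i, j))%:R * (p' == (t, j, k))%:R.
  case: p p' => [[a b] c] [[a' b'] c'] /=; rewrite (bigD1 c) //= big1.
    rewrite addr0 -natrM mulnb /mm_sum /= !xpair_eqE eqxx andbT [b' == c]eq_sym.
    congr ((nat_of_bool _)%:R).
    by case: (a == t); case: (a' == t); case: (c == b'); case: (c' == k);
      case: (b == i).
  by move=> j; rewrite !xpair_eqE [j == c]eq_sym => /negPf ->; rewrite andbF mul0r.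
under eq_bigr => p _ do under eq_bigr => p' _ do rewrite mmE mulr_suml.
under eq_bigr => p _ do rewrite exchange_big.
rewrite exchange_big; apply: eq_bigr => j _ /=.
under eq_bigr => p _ do
  (under eq_bigr => p' _ do rewrite -mulrA; rewrite -mulr_sumr sum_delta).
by rewrite sum_delta.
Qed.

(** Matrices over [I1 * I] are [I1]-matrices of blocks. The rank decomposition replaces the [#|F|]
    block matrix products by [g] products of single blocks, done in [a] batches of [#|F|]. The other
    term pays for three families of linear combinations, two for the factors and one for the
    outputs. *)
Lemma matmul_cost_step (F I1 I : finType) (g a c : nat) :
  (0 < #|F|)%N -> rank_le g (@mm_sum K F I1) -> (g <= a * #|F|)%N ->
  matmul_cost F I c ->
  matmul_cost F (I1 * I)%type (a * c + 6 * g * #|F| * #|I1| ^ 2 * #|I| ^ 2).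
Proof.
move=> F0 [al [be [ga hT]]] gaF mulc S A B Sc SA SB.
pose X : finType := (F * I1 * I1)%type.
pose P m u w d := \sum_(p : X) al m p * A p.1.1 (p.1.2, u) (p.2, w) d.
pose Q m w v d := \sum_(p : X) be m p * B p.1.1 (p.1.2, w) (p.2, v) d.
pose M m u v d := \sum_w P m u w d * Q m w v d.
pose GP := [set f | exists x : 'I_g * I * I, f = P x.1.1 x.1.2 x.2].
pose GQ := [set f | exists x : 'I_g * I * I, f = Q x.1.1 x.1.2 x.2].
have dP : derivable_in S (#|{: 'I_g * I * I}| * (2 * #|X|)) GP.
  by apply: derivable_in_bigcup => x; exact: derivable_in_linear.
have dQ : derivable_in (S `|` GP) (#|{: 'I_g * I * I}| * (2 * #|X|)) GQ.
  apply: derivable_in_bigcup => x; apply: derivable_in_linear.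
    by move=> f /Sc; left.
  by move=> p; left.
have dPQ := derivable_in_trans dP dQ.
pose S1 := S `|` (GP `|` GQ).
pose GM := [set f | exists x : 'I_g * I * I, f = M x.1.1 x.1.2 x.2].
have dM : derivable_in S1 (a * c) GM.
  (* Batch [b] takes the products numbered from [b * #|F|] on; numbers not below [g] are filled with
     zero matrices. *)
  pose ext (h : 'I_g -> I -> I -> D -> K) (b : 'I_a) (t : F) : I -> I -> D -> K :=
    if insub (b * #|F| + enum_rank t)%N is Some m then h m else fun _ _ _ => 0.
  have dMb (b : 'I_a) : derivable_in S1 c [set f | exists t i k,
      f = fun d => \sum_j ext P b t i j d * ext Q b t j k d].
    apply: mulc => [f /Sc|t i j|t i j]; first by left.
      rewrite /ext; case: insub => [m|]; last by left; apply: Sc; exists 0.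
      by right; left; exists (m, i, j).
    rewrite /ext; case: insub => [m|]; last by left; apply: Sc; exists 0.
    by right; right; exists (m, i, j).
  have := derivable_in_bigcup dMb; rewrite card_ord.
  apply: derivable_inW => // f [[[m u] v] ->] /=.
  have mlt : (m %/ #|F| < a)%N.
    by rewrite ltn_divLR // (leq_trans (ltn_ord m)).
  have mod_lt : (m %% #|F| < #|F|)%N by rewrite ltn_mod.
  exists (Ordinal mlt), (enum_val (Ordinal mod_lt)), u, v.
  by rewrite /ext /= enum_valK /= -divn_eq valK.
pose S2 := S `|` (GP `|` GQ `|` GM).
have dS2 := derivable_in_trans dPQ dM.
have dout : derivable_in S2
    (#|{: F * (I1 * I) * (I1 * I)}| * (2 * g))
    [set f | exists x : F * (I1 * I) * (I1 * I),
       f = fun d => \sum_m ga m (x.1.1, x.2.1, x.1.2.1)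
                          * M m x.1.2.2 x.2.2 d].
  apply: derivable_in_bigcup => x; rewrite -[in (2 * g)%N](card_ord g).
  apply: derivable_in_linear => [f /Sc|m]; first by left.
  by right; right; exists (m, x.1.2.2, x.2.2).
have := derivable_in_trans dS2 dout; apply: derivable_inW => //.
  by rewrite !card_prod !card_ord -!mulnn; nia.
move=> f [t [[i u] [[k v] ->]]]; right; exists (t, (i, u), (k, v)).
apply/funext => d /=.
transitivity (\sum_(p : X) \sum_(p' : X) mm_sum K p p' (t, k, i) * \sum_w
    (A p.1.1 (p.1.2, u) (p.2, w) d * B p'.1.1 (p'.1.2, w) (p'.2, v) d)).
  by rewrite mm_sum_contract [RHS]pair_big; apply: eq_bigr; case.
have expand p p' (G : I -> K) : mm_sum K p p' (t, k, i) * \sum_w G w =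
    \sum_m \sum_w al m p * be m p' * ga m (t, k, i) * G w.
  by rewrite hT mulr_suml; apply: eq_bigr => m _; rewrite mulr_sumr.
set rhs := RHS.
under eq_bigr => p _ do under eq_bigr => p' _ do rewrite expand.
under eq_bigr => p _ do rewrite exchange_big /=.
rewrite exchange_big {}/rhs; apply: eq_bigr => m _ /=; rewrite mulr_sumr.
set rhs := RHS.
under eq_bigr => p _ do rewrite exchange_big /=.
rewrite exchange_big {}/rhs; apply: eq_bigr => w _ /=.
rewrite /P /Q big_distrlr mulr_sumr; apply: eq_bigr => p _ /=.
rewrite mulr_sumr; apply: eq_bigr => p' _.
by ring.
Qed.

End Computation.

Fixpoint prod_iter (I : finType) (s : nat) : finType :=
  if s is s'.+1 then (I * prod_iter I s')%type else unit.

Lemma card_prod_iter (I : finType) s : #|prod_iter I s| = (#|I| ^ s)%N.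
Proof. by elim: s => [|s IH] /=; rewrite ?card_unit // card_prod IH expnS. Qed.

(** Each level multiplies the cost by [a]; its linear work is proportional to
    [(#|I| ^ s) ^ 2 <= a ^ s], so the total is [a ^ s] up to a factor linear in [s]. *)
Lemma matmul_cost_iter (D : Type) (K : fieldType) (F I : finType) (g a s : nat) :
  (0 < #|F|)%N -> rank_le g (@mm_sum K F I) -> (g <= a * #|F|)%N ->
  (0 < a)%N -> (#|I| ^ 2 <= a)%N ->
  matmul_cost D K F (prod_iter I s)
    ((#|F| + s * (6 * g * #|F| * #|I| ^ 2)) * a ^ s).
Proof.
move=> F0 rkT gaF a0 Ia; elim: s => [|s IH].
  by rewrite mul0n addn0 muln1; exact: matmul_cost_unit.
have := matmul_cost_step F0 rkT gaF IH; rewrite card_prod_iter.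
set e := (6 * g * _ * _)%N => step S A B Sc SA SB.
apply: derivable_inW (step S A B Sc SA SB) => //.
have le1 : ((#|I| ^ s) ^ 2 <= a ^ s)%N.
  by rewrite expnAC; case: (s) => // s'; rewrite leq_exp2r.
rewrite [(a ^ _.+1)%N]expnS mulSn; move: (a ^ s)%N ((#|I| ^ s) ^ 2)%N le1 => x y le1.
have le2 : (e * y <= e * (a * x))%N.
  by rewrite leq_mul2l (leq_trans le1) ?orbT // leq_pmull.
rewrite (_ : _ * (a * x) = a * ((#|F| + s * e) * x) + e * (a * x))%N.
  by rewrite leq_add2l.
ring.
Qed.

(** * Straight-line programs from name-free computations *)

Section Programs.
Local Open Scope classical_set_scope.

Lemma run_rcons (X : Type) (K : fieldType) (x : X -> K) res p c :
  run x res (rcons p c) =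
  obind (fun r => omap (rcons r) (eval_instr x r c)) (run x res p).
Proof.
elim: p res => [|c' p IH] res /=; first by case: eval_instr.
by case: eval_instr.
Qed.

Lemma eval_operand_rcons (X : Type) (K : fieldType) (x : X -> K) res v o u :
  eval_operand x res o = Some u -> eval_operand x (rcons res v) o = Some u.
Proof.
case: o => //= m; rewrite -cats1 onth_cat; case: ltnP => // le_m.
by rewrite onth_default.
Qed.

(** By induction on the computation: constants and inputs are operands from the start, and the
    function added after [m] instructions is named [Result m]. *)
Lemma computes_program (D X : Type) (K : fieldType) (inp : D -> X -> K)
    (S V : set (D -> K)) (m : nat) :
  (forall f, S f ->
     constants f \/ exists x, f = fun d => inp d x) ->
  computes S m V ->
  exists (p : seq (instr X K)) (res : D -> seq K),
    [/\ size p = m,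
        forall d, run (inp d) [::] p = Some (res d) /\ size (res d) = m &
        forall f, V f -> exists o, forall d,
          eval_operand (inp d) (res d) o = Some (f d)].
Proof.
move=> hS; elim=> [|{}m {}V o f g h _ [p [res [sp rp hV]]] Vf Vg eh].
  exists [::], (fun=> [::]); split=> // f /hS[[a ->]|[x ->]].
    by exists (Const a).
  by exists (Input x).
have [of_ hf] := hV f Vf; have [og hg] := hV g Vg.
exists (rcons p (Instr o of_ og)), (fun d => rcons (res d) (h d)).
split; first by rewrite size_rcons sp.
  move=> d; have [rd sd] := rp d; rewrite size_rcons sd; split=> //.
  by rewrite run_rcons rd /= /eval_instr /= hf hg eh.
move=> f' [/hV[oo' ho'] | ->]; last first.
  by exists (Result m) => d /=; have [_ <-] := rp d; rewrite -cats1 onth_cat ltnn subnn.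
by exists oo' => d; apply: eval_operand_rcons.
Qed.

(** The matrices are padded with zeros to size [#|I|], all [#|F|] products receive the same factors,
    and the copy [t0] is read off. *)
Lemma matmul_in_cost (R : realType) (n : nat) (F I : finType) (c : nat) :
  (0 < #|F|)%N -> (n <= #|I|)%N ->
  matmul_cost ('M[R[i]]_n * 'M[R[i]]_n) R[i] F I c ->
  exists2 s, (s <= c)%N & matmul_in R n s.
Proof.
move=> /card_gt0P[t0 _] nI mulc; pose D : Type := ('M[R[i]]_n * 'M[R[i]]_n)%type.
pose ent (i : I) : option 'I_n := insub (nat_of_ord (enum_rank i)).
pose S : set (D -> R[i]) := @constants D R[i] `|`
  [set f | exists x, f = fun d => mx_input d.1 d.2 x].
pose pad (M : D -> 'M[R[i]]_n) i j d :=
  if ent i is Some i' then if ent j is Some j' then M d i' j' else 0 else 0.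
pose emb (i : 'I_n) : I := enum_val (widen_ord nI i).
have entK i : ent (emb i) = Some i.
  by rewrite /ent /emb enum_valK /= valK.
have Sc : @constants D R[i] `<=` S by move=> f; left.
have SA (t : F) i j : S (pad fst i j).
  rewrite /pad; case: (ent i) => [i'|]; last by left; exists 0.
  case: (ent j) => [j'|]; last by left; exists 0.
  by right; exists (inl (i', j')).
have SB (t : F) i j : S (pad snd i j).
  rewrite /pad; case: (ent i) => [i'|]; last by left; exists 0.
  case: (ent j) => [j'|]; last by left; exists 0.
  by right; exists (inr (i', j')).
have [s [V [sc cV GV]]] := mulc S _ _ Sc SA SB.
have hS f : S f -> constants f \/
   exists x, f = fun d => mx_input d.1 d.2 x by [].
have [p [res [sp rp hV]]] := computes_program hS cV.
have hout (ij : 'I_n * 'I_n) : exists o, forall d : D,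
    eval_operand (mx_input d.1 d.2) (res d) o =
    Some ((d.1 *m d.2) ij.1 ij.2).
  case: ij => i j /=; have [|oij ho] := hV
    (fun d => \sum_l pad fst (emb i) l d * pad snd l (emb j) d).
    by apply: GV; exists t0, (emb i), (emb j).
  exists oij => d; rewrite ho mxE; congr Some.
  rewrite (bigID (fun l => ent l : bool)) /= [X in _ + X]big1 ?addr0 => [|l].
    rewrite (reindex_omap emb ent) => [|l]; last first.
      rewrite /ent; case: insubP => // l' _ el' _ /=; congr Some.
      by apply: enum_rank_inj; rewrite enum_valK; apply: val_inj.
    by apply: eq_big => [l|l _]; rewrite ?entK ?eqxx // /pad !entK.
  by rewrite /pad entK; case: (ent l) => // _; rewrite mul0r.
have [out hout'] := choice hout.
exists s => //; exists p, (fun i j => out (i, j)); split=> // A B.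
exists (res (A, B)); first by have [] := rp (A, B).
by move=> i j; have := hout' (i, j) (A, B).
Qed.

End Programs.

(** * Bounding [omega] by a single rank decomposition *)

Section Exponent.
Variable R : realType.

(** Without instructions an output is an entry of [A] or [B] or a constant, and none of these is 1
    at [(1, 1)] and 0 at both [(0, 1)] and [(1, 0)]. *)
Lemma matmul_in_gt0 (n s : nat) : (0 < n)%N -> matmul_in R n s -> (0 < s)%N.
Proof.
case: n => // n _ [p [out [<- hp]]]; case: p hp => // hp; exfalso.
have hout A B : eval_operand (mx_input A B) [::] (out ord0 ord0) =
    Some ((A *m B) ord0 ord0).
  by have [res [<-]] := hp A B; apply.
move: (hout 1 1) (hout 0 1) (hout 1 0).
rewrite mul0mx mulmx0 mulmx1 !mxE eqxx.
case: (out ord0 ord0) => [[ij|ij]|u|m] /= e11 e01 e10.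
- by move: e10; rewrite e11 => -[/eqP]; rewrite oner_eq0.
- by move: e01; rewrite e11 => -[/eqP]; rewrite oner_eq0.
- by move: e10; rewrite e11 => -[/eqP]; rewrite oner_eq0.
- by move: e11; rewrite onth_default.
Qed.

(** A negative exponent would push the program length below 1. This lower bound is what allows [inf]
    to be estimated by members of the set. *)
Lemma matmul_exponents_ge0 (tau : R) : matmul_exponents tau -> 0 <= tau.
Proof.
move=> [c [N _ hN]]; rewrite leNgt; apply/negP => tau0.
(* Chosen so that [b ^ (- tau) = |c| + 1], hence [c * n ^ tau < 1] once [n >= b]. *)
pose b := (`|c| + 1) `^ (- tau)^-1.
pose n := (maxn N (Num.truncn b).+1).
have n0 : (0 < n)%N by rewrite leq_max orbT.
have [s sn] := hN n (leq_maxl _ _).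
have /= s1 := matmul_in_gt0 n0 sn.
apply/negP; rewrite -ltNge; apply: (@lt_le_trans _ _ 1); last by rewrite ler1n.
have nR : 0 < n%:R :> R by rewrite ltr0n.
have bn : b <= n%:R.
  apply: le_trans (ltW (truncnS_gt b)) _; by rewrite ler_nat leq_maxr.
have : `|c| + 1 <= n%:R `^ (- tau).
  have -> : `|c| + 1 = b `^ (- tau).
    by rewrite /b -powRrM mulVf ?powRr1 ?gt_eqF ?oppr_gt0 // addr_ge0.
  by rewrite ge0_ler_powR ?oppr_ge0 ?nnegrE ?powR_ge0 ?(ltW tau0) ?(ltW nR).
have y0 : 0 < n%:R `^ tau :> R by rewrite powR_gt0.
rewrite powRN -[_^-1]div1r ler_pdivlMr //; apply: lt_le_trans.
by rewrite ltr_pM2r // (le_lt_trans (ler_norm _)) // ltrDl.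
Qed.

(** An [n] by [n] product fits in [k + 1] levels of recursion, with [k = trunc_log m n]. Then
    [a ^ k <= n ^ al], and the factor linear in [k] is absorbed by [n ^ d] for arbitrarily small
    [d]. *)
Lemma omega_le (F I : finType) (g a : nat) :
  (0 < #|F|)%N -> (1 < #|I|)%N -> rank_le g (@mm_sum R[i] F I) ->
  (g <= a * #|F|)%N -> omega R <= ln a%:R / ln #|I|%:R.
Proof.
move=> F0 I1 rkT gaF; set m := #|I|; set al := _ / _.
have mR1 : 1 < m%:R :> R by rewrite ltr1n.
have Ia : (m ^ 2 <= a)%N.
  rewrite -(leq_pmul2r F0) mulnC (leq_trans _ gaF) //.
  by apply: rank_mm_sum_ge rkT; apply: ltnW.
have a0 : (0 < a)%N by rewrite (leq_trans _ Ia) // expn_gt0 (ltnW I1).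
apply/ler_addgt0Pr => d d0; apply: ge_inf.
  by exists 0 => tau; exact: matmul_exponents_ge0.
(* By Bernoulli, [1 + k x <= (1 + x) ^ k = m ^ (d k) <= n ^ d], which bounds [k]. *)
pose x : R := m%:R `^ d - 1.
have x0 : 0 < x.
  rewrite subr_gt0; have {1}<- : 1 `^ d = 1 :> R by rewrite powR1.
  by rewrite gt0_ltr_powR // nnegrE.
pose e := (6 * g * #|F| * m ^ 2)%N.
exists ((#|F| + e)%:R * a%:R * (x^-1 + 1)); exists 1%N => // n /= n0.
pose k := trunc_log m n.
have [s sc sn] : exists2 s, (s <= (#|F| + k.+1 * e) * a ^ k.+1)%N & matmul_in R n s.
  apply: (matmul_in_cost F0 _ (@matmul_cost_iter _ _ _ _ _ _ k.+1 F0 rkT gaF a0 Ia)).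
  by rewrite card_prod_iter ltnW // trunc_log_ltn.
exists s => //.
have nR : 1 <= n%:R :> R by rewrite ler1n.
have mkn : (m%:R ^+ k <= n%:R :> R) by rewrite -natrX ler_nat trunc_logP.
have akE : a%:R ^+ k <= n%:R `^ al.
  have -> : a%:R = m%:R `^ al :> R.
    apply: ln_inj; rewrite ?posrE ?powR_gt0 ?ltr0n // ?(ltnW I1) //.
    by rewrite ln_powR divfK // gt_eqF // ln_gt0.
  rewrite -powR_mulrn ?powR_ge0 // powRAC powR_mulrn //.
  rewrite ge0_ler_powR ?nnegrE ?exprn_ge0 //.
  by rewrite divr_ge0 ?ln_ge0 ?ler1n // ltnW.
have k1n : k.+1%:R <= (x^-1 + 1) * n%:R `^ d.
  have bern : 1 + k%:R * x <= n%:R `^ d.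
    apply: (@le_trans _ _ ((1 + x) ^+ k)).
      elim: (k) => [|j IH]; first by rewrite mul0r addr0 expr0.
      rewrite exprS; apply: (@le_trans _ _ ((1 + x) * (1 + j%:R * x))).
        rewrite -natr1; have : 0 <= j%:R * x * x by rewrite !mulr_ge0 ?(ltW x0).
        by nra.
      by rewrite ler_pM2l // addr_gt0.
    rewrite /x addrC subrK -powR_mulrn ?powR_ge0 // powRAC powR_mulrn //.
    by rewrite ge0_ler_powR ?nnegrE ?exprn_ge0 // ltW.
  have nd1 : 1 <= n%:R `^ d.
    by have {1}<- := powRr0 (n%:R : R); rewrite ler_powR // ltW.
  rewrite -natr1 mulrDl mul1r lerD // mulrC ler_pdivlMr //.
  by rewrite (le_trans _ bern) // lerDr.
have {}sc : (s <= (#|F| + e) * a * k.+1 * a ^ k)%N.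
  apply: leq_trans sc _; rewrite expnS; set y := (a ^ k)%N.
  rewrite (_ : _ * k.+1 * y = (#|F| + e) * k.+1 * (a * y))%N; last by ring.
  by rewrite leq_mul2r mulnDl [(e * _)%N]mulnC leq_add2r leq_pmulr ?orbT.
have scR : s%:R <= (#|F| + e)%:R * a%:R * k.+1%:R * a%:R ^+ k :> R.
  by rewrite -natrX -!natrM ler_nat.
apply: le_trans scR _; rewrite (powRD _ (x := n%:R)) ?pnatr_eq0 ?(gtn_eqF n0) ?implybT //.
rewrite [n%:R `^ al * _]mulrC mulrA ler_pM ?mulr_ge0 ?exprn_ge0 //.
by rewrite -[_ * (x^-1 + 1) * _]mulrA ler_wpM2l // mulr_ge0.
Qed.

End Exponent.

(** * Powers of limits *)

Section Limits.
Local Open Scope classical_set_scope.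
Variable R : realType.
Local Notation C := R[i].

Definition tends (u : nat -> C) (l : C) : Prop :=
  (u : nat -> C^o) @ \oo --> (l : C^o).

Lemma tends_unique (u : nat -> C) (l l' : C) : tends u l -> tends u l' -> l = l'.
Proof. exact: cvg_unique. Qed.

Lemma tends_cst (l : C) : tends (fun=> l) l.
Proof. exact: cvg_cst. Qed.

Lemma tendsM (u v : nat -> C) (l m : C) :
  tends u l -> tends v m -> tends (fun n => u n * v n) (l * m).
Proof. exact: cvgM. Qed.

Lemma tendsD (u v : nat -> C) (l m : C) :
  tends u l -> tends v m -> tends (fun n => u n + v n) (l + m).
Proof. exact: cvgD. Qed.

Lemma tends_sum (J : finType) (u : J -> nat -> C) (l : J -> C) :
  (forall j, tends (u j) (l j)) ->
  tends (fun n => \sum_j u j n) (\sum_j l j).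
Proof.
move=> ul; rewrite unlock; elim: (index_enum J) => [|j s IH] /=.
  exact: tends_cst.
exact: (tendsD (ul j) IH).
Qed.

Lemma tends_prod (J : finType) (u : J -> nat -> C) (l : J -> C) :
  (forall j, tends (u j) (l j)) ->
  tends (fun n => \prod_j u j n) (\prod_j l j).
Proof.
move=> ul; rewrite unlock; elim: (index_enum J) => [|j s IH] /=.
  exact: tends_cst.
exact: (tendsM (ul j) IH).
Qed.

Lemma tendsX (u : nat -> C) (l : C) (k : nat) :
  tends u l -> tends (fun n => u n ^+ k) (l ^+ k).
Proof.
move=> ul; elim: k => [|k IH]; first exact: tends_cst.
rewrite exprS; under eq_fun => n do rewrite exprS; exact: (tendsM ul IH).
Qed.

(* A subspace of a finite-dimensional space is closed, and it is spanned by at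
   most [d] of any family of generators. *)
Lemma limit_in_span (d : nat) (u : nat -> 'rV[C]_d) (l : 'rV[C]_d) :
  (forall j, tends (fun n => u n 0 j) (l 0 j)) ->
  exists k (n : 'I_k -> nat) (c : 'I_k -> C),
    (k <= d)%N /\ l = \sum_i c i *: u (n i).
Proof.
move=> ul.
have dim_le (V : {vspace 'rV[C]_d}) : (\dim V <= d)%N.
  by rewrite (leq_trans (dimvS (subvf V))) // dimvf /dim /= mul1n.
(* Vectors outside the current span are adjoined one at a time; [d + 1] of them cannot be free, so
   at some stage the list spans every [u m]. *)
have grow k : exists s : seq nat,
    (forall m, u m \in <<map u s>>%VS) /\ (size s <= d)%N \/
    free (map u s) /\ size s = k.
  elim: k => [|k [s [[h sd]|[fs sk]]]]; first by exists [::]; right; rewrite nil_free.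
    by exists s; left.
  have [all_in|] := pselect (forall m, u m \in <<map u s>>%VS).
    exists s; left; split=> //; rewrite -(size_map u) -(eqnP fs).
    by apply: dim_le.
  move=> /existsNP[m /negP um]; exists (m :: s); right.
  by rewrite /= sk free_cons um fs.
have [s [s_span s_size]] : exists s : seq nat,
    (forall m, u m \in <<map u s>>%VS) /\ (size s <= d)%N.
  have [s [|[fs sd]]] := grow d.+1; first by exists s.
  by have := dim_le <<map u s>>%VS; rewrite (eqnP fs) size_map sd ltnn.
pose U := <<map u s>>%VS.
(* [phi] is linear, hence continuous, and vanishes exactly on [U]; it kills every [u n], so it kills
   the limit. *)
pose phi (v : 'rV[C]_d) : 'rV[C]_d := v - projv U v.
have phi_sum v j : phi v 0 j = \sum_i v 0 i * phi (delta_mx 0 i) 0 j.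
  rewrite [in LHS](row_sum_delta v) /phi linear_sum -sumrB summxE.
  by apply: eq_bigr => i _; rewrite linearZ -scalerBr mxE.
have l_in : l \in U.
  suff -> : l = projv U l by exact: memv_proj.
  apply/eqP; rewrite -subr_eq0; apply/eqP/matrixP => i j; rewrite ord1 [RHS]mxE.
  have lim1 : tends (fun n => phi (u n) 0 j) (phi l 0 j).
    rewrite phi_sum; under eq_fun => n do rewrite phi_sum.
    apply: tends_sum => i'; exact: (tendsM (ul i') (@tends_cst _)).
  apply: (tends_unique lim1); under eq_fun => n.
    rewrite /phi projv_id; last exact: s_span.
    rewrite subrr mxE; over.
  exact: tends_cst.
have s_sz : size (map u s) = size s by rewrite size_map.
rewrite -s_sz in s_size; exists (size (map u s)), (fun i => nth 0%N s i).
exists (fun i => coord (in_tuple (map u s)) i l); split=> //.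
rewrite {1}(coord_span (X := in_tuple (map u s)) l_in); apply: eq_bigr => i _.
by rewrite (nth_map 0%N) // -s_sz.
Qed.

Lemma prod_fiber (K : comNzRingType) (P Q : finType) (h : P -> Q) (F : Q -> K) :
  \prod_s F (h s) = \prod_p F p ^+ #|[pred s | h s == p]|.
Proof.
rewrite (partition_big h xpredT) //=; apply: eq_bigr => p _.
rewrite (eq_bigr (fun=> F p)) => [|s /eqP -> //].
by rewrite prodr_const.
Qed.

(* The entries of [T ^ P] are monomials of degree [#|P|] in the entries of [T],
   hence the powers [T ^ P] span a space of dimension at most
   [(#|P| + 1) ^ #|X * Y * Z|].  Since the limit of the powers stays in the span
   of the powers, a limit of tensors of rank at most [r] has powers whose rank
   is [r ^ #|P|] up to that polynomial factor. *)
Lemma rank_le_limit_pow (X Y Z P : finType) (r : nat)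
    (S : nat -> X -> Y -> Z -> C) (T : X -> Y -> Z -> C) :
  (forall n, rank_le r (S n)) ->
  (forall x y z, tends (fun n => S n x y z) (T x y z)) ->
  rank_le (#|P|.+1 ^ #|{: X * Y * Z}| * r ^ #|P|) (tensor_pow (P := P) T).
Proof.
move=> rkS lim; pose Q : finType := (X * Y * Z)%type.
pose Mon : finType := {ffun Q -> 'I_#|P|.+1}.
pose mon (V : X -> Y -> Z -> C) (m : Mon) :=
  \prod_(p : Q) V p.1.1 p.1.2 p.2 ^+ m p.
have powE x y z : exists m, forall V,
    tensor_pow (P := P) V x y z = mon V m.
  pose h s : Q := (x s, y s, z s).
  exists [ffun p => inord #|[pred s | h s == p]|] => W.
  rewrite /tensor_pow /mon.
  rewrite (prod_fiber h (fun p => W p.1.1 p.1.2 p.2)).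
  apply: eq_bigr => p _; rewrite ffunE inordK // ltnS; exact: max_card.
have [j|k [n [c [kd mT]]]] :=
    @limit_in_span #|Mon| (fun n => \row_j mon (S n) (enum_val j))
      (\row_j mon T (enum_val j)).
  rewrite mxE; under eq_fun => n do rewrite mxE.
  by apply: tends_prod => p; apply: tendsX; apply: lim.
apply: (@rank_leW _ _ _ _ (k * r ^ #|P|)).
  have <- : #|Mon| = (#|P|.+1 ^ #|Q|)%N by rewrite card_ffun card_ord.
  by rewrite leq_mul2r kd orbT.
have := rank_le_sum c (fun i => rank_le_pow P (rkS (n i))).
move=> [a [b [e hT]]]; exists a, b, e => x y z; rewrite -hT.
have [m mE] := powE x y z.
under eq_bigr => i _ do rewrite mE.
move/matrixP: mT => /(_ 0 (enum_rank m)); rewrite mE mxE enum_rankK => ->.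
by rewrite summxE; apply: eq_bigr => i _; rewrite !mxE enum_rankK.
Qed.

Lemma tends_inv_nat : tends (fun n => n.+1%:R^-1 : C) 0.
Proof.
apply/cvgr0Pnorm_lt => eps eps0.
(* In the order of [R[i]] a positive number is real. *)
have [e e0 ->] : exists2 e : R, 0 < e & eps = (e%:C)%C.
  by case: eps eps0 => a b; rewrite ltcE /= => /andP[/eqP -> a0]; exists a.
exists (Num.truncn e^-1) => // n /= le_n.
have -> : n.+1%:R^-1 = ((n.+1%:R^-1 : R)%:C)%C :> C by rewrite fmorphV rmorph_nat.
rewrite ger0_norm ?lecR ?invr_ge0 // ltcR invf_plt ?posrE ?ltr0n //.
by apply: lt_le_trans (truncnS_gt _) _; rewrite ler_nat.
Qed.

End Limits.

(** * Selecting balanced partitions *)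

Section Colorings.
Variables (P : finType) (N : nat).

Notation coloring := {ffun P -> 'I_3}.
Implicit Types (th : coloring) (c : 'I_3).

Definition color_class th c : {set P} := [set s | th s == c]%SET.

Definition balanced : {set coloring} :=
  [set th | [forall c, #|color_class th c| == N]]%SET.

Lemma balancedP th c : th \in balanced -> #|color_class th c| = N.
Proof. by rewrite inE => /forallP/(_ c)/eqP. Qed.

Lemma coloring_class2 th th' (c d : 'I_3) : c != d ->
  color_class th c = color_class th' c -> color_class th d = color_class th' d ->
  th = th'.
Proof.
move=> cd /setP hc /setP hd; apply/ffunP => s; apply/eqP.
move: (hc s) (hd s) cd; rewrite !inE.
by case: (th s) (th' s) c d {hc hd} => [[|[|[|?]]] ?] [[|[|[|?]]] ?]
  [[|[|[|?]]] ?] [[|[|[|?]]] ?].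
Qed.

(** Once one class is [A], the coloring is determined by a second class, an [N]-subset of the
    complement of [A]. *)
Lemma card_balanced_class c (A : {set P}) : #|P| = (3 * N)%N -> #|A| = N ->
  (#|[set th in balanced | color_class th c == A]%SET| <= 'C(2 * N, N))%N.
Proof.
move=> card_P cA; have [d cd] : exists d : 'I_3, c != d.
  by exists (if c == 0 then 1 else 0); case: ifP => [/eqP ->|/negbT].
have cAC : #|~: A| = (2 * N)%N.
  by have := cardsC A; rewrite cA card_P; lia.
rewrite -cAC -cards_draws -(card_in_imset (f := color_class^~ d)).
  apply/subset_leq_card/fintype.subsetP => B /imsetP[th hth ->].
  move: hth; rewrite [X in is_true X -> _]inE => /andP[thb /eqP <-].
  rewrite inE balancedP // eqxx andbT.
  apply/fintype.subsetP => s; rewrite !inE => /eqP ->; by rewrite eq_sym.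
move=> th th'; rewrite !inE => /andP[_ /eqP e1] /andP[_ /eqP e2] e.
by apply: coloring_class2 cd _ e; rewrite e1 e2.
Qed.

Lemma card_balanced : #|P| = (3 * N)%N ->
  ('C(3 * N, N) * 'C(2 * N, N) <= #|balanced|)%N.
Proof.
move=> card_P; pose W := [set AB : {set P} * {set P} |
  (#|AB.1| == N) && ((AB.2 \subset ~: AB.1) && (#|AB.2| == N))]%SET.
have <- : #|W| = ('C(3 * N, N) * 'C(2 * N, N))%N.
  rewrite -sum1_card (eq_bigl (fun AB : {set P} * {set P} => (#|AB.1| == N) &&
    ((AB.2 \subset ~: AB.1) && (#|AB.2| == N)))) => [|AB]; last by rewrite inE.
  rewrite -(pair_big_dep (fun A : {set P} => #|A| == N)
    (fun A B : {set P} => (B \subset ~: A) && (#|B| == N)) (fun _ _ => 1%N)) /=.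
  rewrite (eq_bigr (fun=> 'C(2 * N, N))) => [|A /eqP cA].
    by rewrite sum_nat_const -cardsE card_draws card_P.
  rewrite sum1_card -cardsE cards_draws; congr 'C(_, _).
  by have := cardsC A; rewrite cA card_P; lia.
pose f (AB : {set P} * {set P}) : coloring :=
  [ffun s => if s \in AB.1 then 0 else if s \in AB.2 then 1 else 2].
have f0 AB : color_class (f AB) 0 = AB.1.
  by apply/setP => s; rewrite !inE ffunE; case: (s \in AB.1) => //; case: (s \in AB.2).
have f1 (AB : {set P} * {set P}) : AB.2 \subset ~: AB.1 -> color_class (f AB) 1 = AB.2.
  move=> /fintype.subsetP sub; apply/setP => s; rewrite !inE ffunE.
  case: ifP => [s1|_]; last by case: ifP.
  by apply/esym/negbTE/negP => /sub; rewrite inE s1.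
rewrite -(card_in_imset (f := f)) => [|AB AB']; last first.
  rewrite !inE => /and3P[_ sAB _] /and3P[_ sAB' _] e.
  by apply/eqP; rewrite -pair_eqE /pair_eq -(f0 AB) -(f0 AB') -(f1 AB) // -(f1 AB') // e !eqxx.
apply/subset_leq_card/fintype.subsetP => th /imsetP[AB hAB ->].
move: hAB; rewrite !inE => /and3P[/eqP cA sAB /eqP cB]; apply/forallP => c.
have part : (#|color_class (f AB) 0%R| + #|color_class (f AB) 1%R| +
    #|color_class (f AB) 2%R| = 3 * N)%N.
  rewrite -card_P -[#|P|]cardsT -cardsUI (_ : _ :&: _ = finset.set0) ?cards0 ?addn0.
    rewrite -cardsUI (_ : _ :&: color_class _ _ = finset.set0) ?cards0 ?addn0.
      congr #|pred_of_set _|; apply/setP => s; rewrite !inE.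
      by case: (f AB s) => [[|[|[|?]]] ?].
    apply/setP => s; rewrite !inE; by case: (f AB s) => [[|[|[|?]]] ?].
  by apply/setP => s; rewrite !inE; case: (f AB s) => [[|[|[|?]]] ?].
move: part; rewrite f0 f1 // cA cB => part.
have c2 : #|color_class (f AB) 2| = N by lia.
case: c => [[|[|[|//]]] lt_c] /=.
- by rewrite (_ : Ordinal _ = 0) ?f0 ?cA //; apply: val_inj.
- by rewrite (_ : Ordinal _ = 1) ?f1 ?cB //; apply: val_inj.
- by rewrite (_ : Ordinal _ = 2) ?c2 //; apply: val_inj.
Qed.

Definition class_sum p (v : {ffun P -> 'I_p}) th c : nat :=
  (\sum_(s in color_class th c) v s)%N.

(** The equation is between integers, not residues. Both hashes are at most [N * p] on a balanced
    coloring, so the shift by [N * p] makes the solution [o.2] nonnegative and at most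
    [2 * (N * p)]. *)
Definition hashed p (o : {ffun P -> 'I_p} * 'I_(2 * (N * p)).+1) th : bool :=
  (class_sum o.1 th 0%R + o.2 == class_sum o.1 th 1%R + N * p)%N.

Lemma class_sum_le p (v : {ffun P -> 'I_p}) th c :
  th \in balanced -> (class_sum v th c <= N * p)%N.
Proof.
move=> thb; rewrite -(balancedP c thb) -sum_nat_const.
by apply: leq_sum => s _; exact: ltnW.
Qed.

Lemma card_hashed_ge p th : th \in balanced ->
  (#|{ffun P -> 'I_p}| <=
   #|[set o : {ffun P -> 'I_p} * 'I_(2 * (N * p)).+1 | hashed o th]%SET|)%N.
Proof.
move=> thb; pose f (v : {ffun P -> 'I_p}) : _ * 'I_(2 * (N * p)).+1 :=
  (v, inord (class_sum v th 1%R + N * p - class_sum v th 0%R)).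
rewrite -(card_imset (f := f)) => [|v v' [] //].
apply/subset_leq_card/fintype.subsetP => o /imsetP[v _ ->].
have := class_sum_le v 0 thb; have := class_sum_le v 1 thb => h1 h0.
by rewrite inE /hashed /= inordK; [apply/eqP; lia | rewrite ltnS; lia].
Qed.

(** Subtracting the two equations eliminates the offset and leaves a linear relation on [v] whose
    coefficient is nonzero at a point [s0] where the colorings differ. So [v s0] is determined by
    the other values, and the offset by [v]; overwriting [v s0] freely gives [p] distinct functions
    for each solution. *)
Lemma card_hashed2_le p th th' : th != th' ->
  (p * #|[set o : {ffun P -> 'I_p} * 'I_(2 * (N * p)).+1
           | hashed o th && hashed o th']%SET| <= #|{ffun P -> 'I_p}|)%N.
Proof.
move=> ne; have [s0 ne0] : exists s0, th s0 != th' s0.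
  apply/existsP; apply: contraNT ne => /existsPn h; apply/eqP/ffunP => s.
  by apply/eqP/negbNE/h.
set A := [set o | _]%SET.
(* Distinct colors get distinct weights, so the coefficient at [s0] does not vanish. *)
pose eps (c : 'I_3) : int := if c == 0 then -1 else if c == 1 then 1 else 0.
have epsE (v : {ffun P -> 'I_p}) t : (class_sum v t 1)%:Z - (class_sum v t 0)%:Z =
    \sum_s eps (t s) * (v s)%:Z.
  rewrite /class_sum -[X in X - _]natz -[X in _ - X]natz !natr_sum.
  rewrite (big_mkcond (fun s => s \in _)) /=.
  rewrite [X in _ - X](big_mkcond (fun s => s \in _)) /= -sumrB.
  apply: eq_bigr => s _; rewrite !inE /eps !natz.
  by case: (t s) => [[|[|[|?]]] ?] //=; lia.
have eq0 o : o \in A -> \sum_s (eps (th s) - eps (th' s)) * (o.1 s)%:Z = 0.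
  rewrite inE => /andP[/eqP h /eqP h'].
  under eq_bigr => s _ do rewrite mulrBl.
  rewrite sumrB -!epsE.
  have aux (a b c d w m : nat) : (a + w = b + m)%N -> (c + w = d + m)%N ->
      b%:Z - a%:Z - (d%:Z - c%:Z) = 0 by lia.
  exact: aux h h'.
pose f (ox : ({ffun P -> 'I_p} * 'I_(2 * (N * p)).+1) * 'I_p) : {ffun P -> 'I_p} :=
  [ffun s => if s == s0 then ox.2 else ox.1.1 s].
have <- : #|finset.setX A [set: 'I_p]%SET| = (p * #|A|)%N.
  by rewrite cardsX cardsT card_ord mulnC.
rewrite -(card_in_imset (f := f)) ?max_card // => -[[v w] x] [[v' w'] x'].
rewrite !finset.in_setX => /andP[ho1 _] /andP[ho2 _] /ffunP e.
have xx : x = x' by have := e s0; rewrite !ffunE eqxx.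
have vv s : s != s0 -> v s = v' s.
  by move=> /negPf ns; have := e s; rewrite !ffunE ns.
have v0 : v s0 = v' s0.
  have := etrans (eq0 _ ho1) (esym (eq0 _ ho2)); rewrite (bigD1 s0) //= [RHS](bigD1 s0) //=.
  rewrite (eq_bigr (fun s => (eps (th s) - eps (th' s)) * (v' s)%:Z)); last first.
    by move=> s /vv ->.
  move/addIr => e0; have /mulfI inj : eps (th s0) - eps (th' s0) != 0.
    move: ne0; rewrite /eps.
    by case: (th s0) (th' s0) => [[|[|[|?]]] ?] [[|[|[|?]]] ?].
  by apply: val_inj; have [] := inj _ _ e0.
have vE : v = v'.
  by apply/ffunP => s; have [->|/vv] := eqVneq s s0.
move: ho1 ho2; rewrite -vE xx !inE /hashed /= => /andP[/eqP h _] /andP[/eqP h' _].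
by congr ((_, _), _); apply: val_inj => /=; move: h h' => /=; lia.
Qed.

End Colorings.

Section Select.
Variables (P : finType) (N : nat).
Hypothesis card_P : #|P| = (3 * N)%N.
Hypothesis N_gt0 : (0 < N)%N.
Notation coloring := {ffun P -> 'I_3}.
Implicit Types (th : coloring) (c : 'I_3).

Definition conflict th th' : bool :=
  (th != th') && [exists c, color_class th c == color_class th' c].

Definition isolated_colorings p (o : {ffun P -> 'I_p} * 'I_(2 * (N * p)).+1) :
    {set coloring} :=
  [set th in balanced P N | hashed o th &&
    [forall th', (th' \in balanced P N) && hashed o th' ==> ~~ conflict th th']]%SET.

(* First moment method: for [p = 6 * 'C(2N, N)] and a random [o], a given
   coloring is hashed with probability 1 / (2Np + 1), and two given colorings
   are simultaneously hashed [p] times less often. *)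
Lemma isolated_large : exists (p : nat)
    (o : {ffun P -> 'I_p} * 'I_(2 * (N * p)).+1),
  ('C(3 * N, N) <= 26 * N * #|isolated_colorings o|)%N.
Proof.
pose D := 'C(2 * N, N); pose p := (6 * D)%N.
have D0 : (0 < D)%N by rewrite bin_gt0 leq_pmull.
pose O := ({ffun P -> 'I_p} * 'I_(2 * (N * p)).+1)%type.
pose B := balanced P N; pose V := #|{ffun P -> 'I_p}|.
have V0 : (0 < V)%N by rewrite /V card_ffun card_ord expn_gt0 muln_gt0 D0.
exists p.
(* Each of the three classes is shared with at most [D] balanced colorings. *)
have conf_le th : th \in B ->
    (\sum_(th' in B | conflict th th') 1 <= 3 * D)%N.
  move=> thB; have -> : (3 * D = \sum_(c < 3) D)%N by rewrite sum_nat_const card_ord.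
  apply: (@leq_trans (\sum_c \sum_(th' in B | color_class th' c == color_class th c) 1)%N).
    rewrite (exchange_big_dep (fun th' => th' \in B)) /=; last by move=> c th' _ /andP[].
    rewrite big_mkcondr; apply: leq_sum => th' th'B; case: ifP => // /andP[_ /existsP[c /eqP e]].
    by rewrite (bigD1 c) /= ?th'B ?e ?eqxx.
  apply: leq_sum => c _.
  apply: leq_trans (card_balanced_class c card_P (balancedP c thB)).
  by rewrite -sum1_card; apply/eq_leq/eq_bigl => th'; rewrite inE.
have sel_le (o : O) : (\sum_(th in B) hashed o th <= #|isolated_colorings o| +
    \sum_(th in B) \sum_(th' in B | conflict th th') (hashed o th && hashed o th'))%N.
  rewrite -sum1_card big_mkcond [X in (_ <= X + _)%N]big_mkcond.
  rewrite [X in (_ <= _ + X)%N]big_mkcond -big_split; apply: leq_sum => th _ /=.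
  case: ifP => //= thB; case hth : (hashed o th) => //=.
  case: ifPn => [//|]; rewrite finset.in_set -/B thB hth /= => /forallPn[th'].
  rewrite negb_imply negbK => /andP[/andP[th'B hth'] conf].
  by rewrite add0n (bigD1 th') ?th'B //= hth'.
have total_le : (\sum_(o : O) \sum_(th in B) hashed o th <=
    \sum_(o : O) #|isolated_colorings o| +
    \sum_(o : O) \sum_(th in B) \sum_(th' in B | conflict th th')
      (hashed o th && hashed o th'))%N.
  by rewrite -big_split; apply: leq_sum => o _; exact: sel_le.
have hashed_ge : (#|B| * V <= \sum_(o : O) \sum_(th in B) hashed o th)%N.
  rewrite exchange_big /= -sum_nat_const; apply: leq_sum => th thB.
  apply: leq_trans (card_hashed_ge p thB) _.
  by rewrite -sum1_card big_mkcond; apply: leq_sum => o _; rewrite inE; case: hashed.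
have pairs_le : (p * \sum_(o : O) \sum_(th in B) \sum_(th' in B | conflict th th')
      (hashed o th && hashed o th') <= #|B| * (3 * D * V))%N.
  rewrite exchange_big /= big_distrr /= -sum_nat_const; apply: leq_sum => th thB.
  rewrite exchange_big /= big_distrr /=.
  apply: (@leq_trans (\sum_(th' in B | conflict th th') 1 * V)%N); last first.
    by rewrite -big_distrl leq_mul2r conf_le ?orbT.
  apply: leq_sum => th' /andP[_ /andP[ne _]]; rewrite mul1n.
  apply: leq_trans (card_hashed2_le N p ne); rewrite leq_mul2l; apply/orP; right.
  rewrite -sum1_card [X in (_ <= X)%N]big_mkcond; apply: leq_sum => o _.
  by rewrite inE; case: (_ && _).
have iso_ge : (#|B| * V <= 2 * \sum_(o : O) #|isolated_colorings o|)%N.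
  move: total_le hashed_ge pairs_le; set x := (\sum_o _)%N; set y := (\sum_o _)%N.
  set z := (\sum_o _)%N => xyz Bx; rewrite /p => zD.
  (* With [p = 6 D], the conflicting pairs account for at most half of [#|B| * V]. *)
  have : (2 * z <= #|B| * V)%N.
    rewrite -(leq_pmul2l (_ : 0 < 3 * D)%N) ?muln_gt0 //.
    by move: zD; rewrite mulnCA (_ : (3 * D * (2 * z) = 6 * D * z)%N) //; lia.
  lia.
have [om ho] : exists o : O, (#|B| <= 2 * (2 * (N * p)).+1 * #|isolated_colorings o|)%N.
  apply/existsP; apply: contraT => /existsPn h.
  have : (\sum_(o : O) (2 * (2 * (N * p)).+1 * #|isolated_colorings o|).+1 <= \sum_(o : O) #|B|)%N.
    by apply: leq_sum => o _; rewrite ltnNge h.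
  rewrite sum_nat_const card_prod card_ord -/V.
  under eq_bigr => o _ do rewrite -addn1.
  rewrite big_split /= -big_distrr /= sum_nat_const card_prod card_ord -/V muln1.
  move: iso_ge; move: (\sum_o _)%N => y iso_ge.
  have : (0 < V * (2 * (N * p)).+1)%N by rewrite muln_gt0 V0.
  move: iso_ge; move: (2 * (N * p)).+1 #|B|; clearbody V => q b iso_ge vq.
  have := leq_mul (leqnn q) iso_ge.
  rewrite (_ : V * q * b = q * (b * V))%N; last by ring.
  rewrite (_ : 2 * q * y = q * (2 * y))%N; last by ring.
  by move=> le1 le2; have := leq_trans le2 le1; rewrite leqNgt -addn1 leq_add2l vq.
(* The factor [D] cancels; the constant 26 comes from [2 (12 N D + 1) <= 26 N D]. *)
exists om; rewrite -(leq_pmul2r D0).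
apply: leq_trans (card_balanced card_P) _; apply: leq_trans ho _.
rewrite /p; move: #|isolated_colorings om| => m.
rewrite [leqRHS](_ : _ = 26 * (N * D) * m)%N; last by ring.
rewrite leq_mul2r; apply/orP; right.
have : (0 < N * D)%N by rewrite muln_gt0 N_gt0.
rewrite (_ : N * (6 * D) = 6 * (N * D))%N; last by ring.
lia.
Qed.

End Select.

(** * The blocks of the skew Coppersmith-Winograd tensor *)

Section Skewcw.
Variables (K : fieldType) (q : nat).
Hypothesis q_even : ~~ odd q.
Let h := (q %/ 2)%N.

Let q_half : q = (h + h)%N.
Proof. by rewrite addnn /h divn2 even_halfK. Qed.

Lemma sum_nat_delta (m n i : nat) (F : nat -> K) :
  \sum_(m <= j < n) (i == j)%:R * F j = (m <= i < n)%N%:R * F i.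
Proof.
case: (boolP (m <= i < n)%N) => [hi|hi].
  rewrite (bigD1_seq i) ?mem_index_iota ?iota_uniq //= eqxx big1 ?addr0 // => j.
  by rewrite eq_sym => /negPf ->; rewrite mul0r.
rewrite mul0r big_nat big1 // => j hj; case: eqP hi => [->|]; last by rewrite mul0r.
by rewrite hj.
Qed.

Definition skew_coef (x y z : 'I_q.+1) : K := skewcw K q (x, y, z).

Lemma skewE (x y z : 'I_q.+1) : skew_coef x y z =
  [&& x == 0 :> nat, y != 0 :> nat & y == z]%:R +
  [&& y == 0 :> nat, x != 0 :> nat & x == z]%:R +
  (z == 0 :> nat)%:R * ([&& 0 < x, x <= h & y == x + h :> nat]%N%:R -
                        [&& 0 < y, y <= h & x == y + h :> nat]%N%:R).
Proof.
have lx := ltn_ord x; have ly := ltn_ord y; have lz := ltn_ord z.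
rewrite /skew_coef /skewcw /= -/h ffunE !sum_ffunE; congr (_ + _).
  transitivity (\sum_(1 <= j < q.+1)
     ((y == j :> nat)%:R * ((x == 0 :> nat)%:R * (z == j :> nat)%:R) +
      (x == j :> nat)%:R * ((y == 0 :> nat)%:R * (z == j :> nat)%:R)) : K).
    by apply: eq_bigr => j _; rewrite !ffunE /=; ring.
  rewrite big_split /= !sum_nat_delta /= !ltnS -!natrM !mulnb.
  congr ((nat_of_bool _)%:R + (nat_of_bool _)%:R).
    rewrite !val_eqE [z == y]eq_sym; case: (y == z); rewrite ?andbF ?andbT //.
    by rewrite lt0n -ltnS ly andbT andbC.
  rewrite val_eqE [z == x]eq_sym; case: (x == z); rewrite ?andbF ?andbT //.
  by rewrite lt0n -ltnS lx andbT andbC.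
transitivity (\sum_(1 <= j < h.+1)
   ((x == j :> nat)%:R * ((y == j + h :> nat)%N%:R * (z == 0 :> nat)%:R) -
    (y == j :> nat)%:R * ((x == j + h :> nat)%N%:R * (z == 0 :> nat)%:R)) : K).
  by apply: eq_bigr => j _; rewrite !ffunE /=; ring.
rewrite sumrB !sum_nat_delta !ltnS mulrBr -!natrM !mulnb.
by congr (_ - _); congr ((nat_of_bool _)%:R); rewrite [RHS]andbC -!andbA.
Qed.

(** ['I_q] indexes the basis vectors other than the zeroth, through [lift ord0]; the matching
    [xi <-> xi + q/2] becomes the swap of the halves [b < h] and [b >= h]. *)
Definition twist (b : 'I_q) : 'I_q :=
  insubd b (if (b < h)%N then (b + h)%N else (b - h)%N).

Definition twist_sign (a : 'I_q) : K := if (a < h)%N then 1 else -1.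

Lemma val_twist b : twist b = (if (b < h)%N then (b + h)%N else (b - h)%N) :> nat.
Proof.
rewrite /twist val_insubd; have := ltn_ord b.
by have [hb|hb] := ltnP b h => lb; case: ifP => //; lia.
Qed.

Lemma skew0 (a b : 'I_q) : skew_coef ord0 (lift ord0 a) (lift ord0 b) = (a == b)%:R.
Proof.
rewrite skewE !lift0 /= (inj_eq (@lift_inj _ _)) mul0r addr0.
by rewrite addr0.
Qed.

Lemma skew1 (a b : 'I_q) : skew_coef (lift ord0 a) ord0 (lift ord0 b) = (a == b)%:R.
Proof.
rewrite skewE !lift0 /= (inj_eq (@lift_inj _ _)) mul0r addr0.
by rewrite add0r.
Qed.

(** The twist turns the alternating form of this block into a diagonal one with signs: [+1] from
    [a_xi b_(xi+h)], [-1] from [a_(xi+h) b_xi]. *)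
Lemma skew2 (a b : 'I_q) :
  skew_coef (lift ord0 a) (lift ord0 (twist b)) ord0 = twist_sign a * (a == b)%:R.
Proof.
rewrite skewE !lift0 /= !add0r mul1r val_twist /twist_sign -val_eqE /=.
have := ltn_ord a; have := ltn_ord b; rewrite {2 4}q_half => lb la.
set U := (_ && _); set V := (_ && _).
have [ha|ha] := ltnP a h; rewrite ?mul1r ?mulN1r.
  have -> : U = (a == b :> nat) by rewrite /U; case: (ltnP b h); lia.
  have -> : V = false by rewrite /V; case: (ltnP b h); lia.
  by rewrite subr0.
have -> : V = (a == b :> nat) by rewrite /V; case: (ltnP b h); lia.
have -> : U = false by rewrite /U; case: (ltnP b h); lia.
by rewrite sub0r.
Qed.

(** In a nonzero entry of a power, the zero indices of the three factors thus occupy sets that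
    partition the positions. *)
Lemma skew_support (x y z : 'I_q.+1) : skew_coef x y z != 0 ->
  ((x == 0 :> nat) + (y == 0 :> nat) + (z == 0 :> nat) = 1)%N.
Proof.
move=> ne0; apply/eqP; apply: contraNT ne0 => ne1.
rewrite skewE mulrBr -!natrM !mulnb -!val_eqE /=.
move: (nat_of_ord x) (nat_of_ord y) (nat_of_ord z) ne1 => {x y z} x y z ne1.
set A := (_ && _); set B := (_ && _); set U := (_ && _); set V := (_ && _).
have -> : A = false by rewrite /A; lia.
have -> : B = false by rewrite /B; lia.
have -> : U = false by rewrite /U; lia.
have -> : V = false by rewrite /V; lia.
by rewrite subrr !addr0.
Qed.

End Skewcw.

Section Blocks.
Variables (K : fieldType) (q : nat) (P : finType) (n : nat).
Hypothesis q_even : ~~ odd q.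
Notation N := n.+1.
Notation coloring := {ffun P -> 'I_3}.
Notation I := {ffun 'I_N -> 'I_q}.
Implicit Types (th : coloring) (i j k : I).

(** On a balanced coloring this numbers each class by ['I_N], so that the nonzero indices along one
    class form a single element of [I]. *)
Definition class_rank th (s : P) : 'I_N :=
  inord (index s (enum (color_class th (th s)))).

Lemma class_rank_surj th (c : 'I_3) (m : 'I_N) : th \in balanced P N ->
  exists2 s, th s = c & class_rank th s = m.
Proof.
move=> thb; pose A := color_class th c.
have cA : N = #|A| by rewrite (balancedP c thb).
pose s : P := enum_val (cast_ord cA m).
have sA : th s = c by apply/eqP; have := enum_valP (cast_ord cA m); rewrite inE.
exists s => //; rewrite /class_rank sA.
have -> : index s (enum A) = m.
  by rewrite /s /enum_val index_uniq ?enum_uniq // -cardE; exact: (ltn_ord (cast_ord cA m)).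
by rewrite inord_val.
Qed.

(** The index [i] lives on class 1, [j] on class 2 and [k] on class 0. The three factors have index
    zero on classes 0, 1 and 2 respectively, so each of [i], [j], [k] is shared by two factors, as
    in [x_ij y_jk z_ki]. *)
Definition block1 th i j (s : P) : 'I_q.+1 :=
  if th s == 0 then ord0
  else if th s == 1 then lift ord0 (i (class_rank th s))
  else lift ord0 (j (class_rank th s)).

Definition block2 th j k (s : P) : 'I_q.+1 :=
  if th s == 0 then lift ord0 (k (class_rank th s))
  else if th s == 1 then ord0
  else lift ord0 (twist (j (class_rank th s))).

Definition block3 th k i (s : P) : 'I_q.+1 :=
  if th s == 0 then lift ord0 (k (class_rank th s))
  else if th s == 1 then lift ord0 (i (class_rank th s))
  else ord0.

Definition block_sign th j : K :=
  \prod_s (if (th s == 0) || (th s == 1) then 1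
           else twist_sign K (j (class_rank th s))).

Lemma block_signK th j : block_sign th j * block_sign th j = 1.
Proof.
rewrite -big_split big1 // => s _ /=; rewrite /twist_sign.
by case: ifP => _; [|case: ifP => _]; rewrite ?mulr1 // mulrNN mulr1.
Qed.

Lemma tensor_pow_block th i j j' k k' i' : th \in balanced P N ->
  tensor_pow (@skew_coef K q) (block1 th i j) (block2 th j' k) (block3 th k' i') =
  block_sign th j * [&& j == j', k == k' & i == i']%:R.
Proof.
move=> thb; rewrite /tensor_pow /block_sign.
pose b s := if th s == 0 then k (class_rank th s) == k' (class_rank th s)
  else if th s == 1 then i (class_rank th s) == i' (class_rank th s)
  else j (class_rank th s) == j' (class_rank th s).
have -> : [&& j == j', k == k' & i == i'] = [forall s, b s].
  apply/and3P/forallP => [[/eqP ej /eqP ek /eqP ei] s|hb].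
    by rewrite /b ej ek ei !eqxx !if_same.
  split; apply/eqP/ffunP => m.
  - have [s sc <-] := class_rank_surj 2 m thb.
    by have := hb s; rewrite /b sc => /eqP.
  - have [s sc <-] := class_rank_surj 0 m thb.
    by have := hb s; rewrite /b sc => /eqP.
  - have [s sc <-] := class_rank_surj 1 m thb.
    by have := hb s; rewrite /b sc => /eqP.
rewrite -prodr_bool -big_split; apply: eq_bigr => s _ /=.
rewrite /b /block1 /block2 /block3.
case: ifP => [_|s0]; first by rewrite skew0 // mul1r.
case: ifP => [_|s1]; first by rewrite skew1 // mul1r.
by rewrite skew2.
Qed.

(** By [skew_support], class 0 of [th1], class 1 of [th2] and class 2 of [th3] partition the
    positions, and [th] is that partition. Blocks of different colorings can therefore meet, which
    is why isolated colorings are needed. *)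
Lemma tensor_pow_block_support th1 th2 th3 i j j' k k' i' :
  th1 \in balanced P N -> th2 \in balanced P N -> th3 \in balanced P N ->
  tensor_pow (@skew_coef K q) (block1 th1 i j) (block2 th2 j' k) (block3 th3 k' i')
    != 0 ->
  exists th, [/\ th \in balanced P N, color_class th1 0 = color_class th 0,
    color_class th2 1 = color_class th 1 & color_class th3 2 = color_class th 2].
Proof.
move=> b1 b2 b3 /prodf_neq0 ne0.
have one s : ((th1 s == 0)%R + (th2 s == 1)%R + (th3 s == 2)%R = 1)%N.
  have := skew_support q_even (ne0 s isT); rewrite /block1 /block2 /block3.
  move: (th1 s) (th2 s) (th3 s).
  by case=> [[|[|[|?]]] ?] //; case=> [[|[|[|?]]] ?] //; case=> [[|[|[|?]]] ?].
pose th : coloring :=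
  [ffun s => if th1 s == 0 then 0 else if th2 s == 1 then 1 else 2].
have e1 : color_class th1 0 = color_class th 0.
  apply/setP => s; rewrite !inE ffunE; case: ifP => // _; by case: ifP.
have e2 : color_class th2 1 = color_class th 1.
  apply/setP => s; rewrite !inE ffunE.
  by have := one s; case: (th1 s == 0); case: (th2 s == 1).
have e3 : color_class th3 2 = color_class th 2.
  apply/setP => s; rewrite !inE ffunE.
  by have := one s; case: (th1 s == 0); case: (th2 s == 1); case: (th3 s == 2).
exists th; split=> //; rewrite inE; apply/forallP => c.
case: c => [[|[|[|//]]] lt_c] /=.
- by rewrite (_ : Ordinal _ = 0) -?e1 ?(balancedP _ b1) //; apply: val_inj.
- by rewrite (_ : Ordinal _ = 1) -?e2 ?(balancedP _ b2) //; apply: val_inj.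
- by rewrite (_ : Ordinal _ = 2) -?e3 ?(balancedP _ b3) //; apply: val_inj.
Qed.

End Blocks.

(** * Degeneration to a direct sum of matrix multiplications *)

Section Laser.
Variables (R : realType) (q : nat) (P : finType) (n : nat).
Hypothesis q_even : ~~ odd q.
Notation C := R[i].
Notation N := n.+1.
Hypothesis card_P : #|P| = (3 * N)%N.
Notation coloring := {ffun P -> 'I_3}.
Notation I := {ffun 'I_N -> 'I_q}.

Lemma skew_laser (rho : nat) :
  rank_le rho (tensor_pow (P := P) (@skew_coef C q)) ->
  exists (F : finType) (S : nat -> F * I * I -> F * I * I -> F * I * I -> C),
    [/\ ('C(3 * N, N) <= 26 * N * #|F|)%N,
        forall m, rank_le rho (S m) &
        forall x y z, tends (fun m => S m x y z) (mm_sum C x y z)].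
Proof.
move=> rk_pow; have [p [om om_large]] := isolated_large card_P isT.
pose F : finType := {th : coloring | th \in isolated_colorings om}.
have F_bal (t : F) : sval t \in balanced P N.
  by case: t => th /=; rewrite inE => /andP[].
have F_iso (t : F) th : th \in balanced P N -> hashed om th ->
    (exists c, color_class (sval t) c = color_class th c) -> sval t = th.
  case: t => t /=; rewrite inE => /and3P[_ _ /forallP/(_ th)/implyP iso] thb ho.
  move=> [c ec]; apply/eqP; have := iso; rewrite thb ho => /(_ isT).
  rewrite negb_and negbK => /orP[//|/existsPn/(_ c)].
  by rewrite ec eqxx.
pose v := om.1; pose w := om.2; pose total := (\sum_s v s)%N.
pose be (t : F) := (class_sum v (sval t) 0%R + w)%N.
pose ga (t : F) := (class_sum v (sval t) 1%R + N * p)%N.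
(* Equal to [be + ga] whenever the three sets partition the positions, although it depends only on
   the third set. *)
pose de (t : F) := (total + w + N * p - class_sum v (sval t) 2%R)%N.
pose e m : C := m.+1%:R^-1.
have e0 m : e m != 0 by rewrite invr_eq0 pnatr_eq0.
pose fx (x : F * I * I) := block1 (sval x.1.1) x.1.2 x.2.
pose fy (x : F * I * I) := block2 (sval x.1.1) x.1.2 x.2.
pose fz (x : F * I * I) := block3 (sval x.1.1) x.1.2 x.2.
pose sgn (x : F * I * I) : C := block_sign C (sval x.1.1) x.2.
(* The weights: 2 b^2 + 2 c^2 - (b + c)^2 = (b - c)^2. *)
pose S m x y z := (sgn x * e m ^+ (2 * be x.1.1 ^ 2)) * e m ^+ (2 * ga y.1.1 ^ 2) *
  (e m ^+ (de z.1.1 ^ 2))^-1 * tensor_pow (@skew_coef C q) (fx x) (fy y) (fz z).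
exists F, S; split.
- by rewrite card_sig (eq_card (B := isolated_colorings om)).
- move=> m; exact: (rank_le_map fx fy fz (fun x => sgn x * e m ^+ (2 * be x.1.1 ^ 2))
    (fun y => e m ^+ (2 * ga y.1.1 ^ 2)) (fun z => (e m ^+ (de z.1.1 ^ 2))^-1) rk_pow).
move=> x y z; pose tp := tensor_pow (@skew_coef C q) (fx x) (fy y) (fz z).
have tpE : x.1.1 = z.1.1 -> y.1.1 = z.1.1 -> sgn x * tp = mm_sum C x y z.
  case: x y z @tp => [[t i] j] [[t' j'] k] [[t'' k'] i'] /= -> ->.
  by rewrite tensor_pow_block // mulrA block_signK mul1r /mm_sum /= !eqxx.
have mm_eq : mm_sum C x y z != 0 -> x.1.1 = z.1.1 /\ y.1.1 = z.1.1.
  by rewrite pnatr_eq0 eqb0 negbK => /and5P[/eqP ex /eqP ey _ _ _].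
have [tp0|tp0] := eqVneq tp 0.
  have -> : mm_sum C x y z = 0.
    by apply/eqP/negPn/negP => /[dup] ne /mm_eq[ex ey]; move: ne; rewrite -tpE // tp0 mulr0 eqxx.
  rewrite /S -/tp tp0; under eq_fun => m do rewrite mulr0; exact: tends_cst.
have [th [thb e1 e2 e3]] :=
  tensor_pow_block_support q_even (F_bal _) (F_bal _) (F_bal _) tp0.
have beE : be x.1.1 = (class_sum v th 0%R + w)%N by rewrite /be /class_sum e1.
have gaE : ga y.1.1 = (class_sum v th 1%R + N * p)%N by rewrite /ga /class_sum e2.
have deE : de z.1.1 = (be x.1.1 + ga y.1.1)%N.
  have : total = (class_sum v th 0%R + (class_sum v th 1%R + class_sum v th 2%R))%N.
    rewrite /total (bigID (mem (color_class th 0))) /=; congr (_ + _)%N.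
    rewrite (bigID (mem (color_class th 1))) /=; congr (_ + _)%N.
      by apply: eq_bigl => s; rewrite !inE; case: (th s) => [[|[|[|?]]] ?].
    by apply: eq_bigl => s; rewrite !inE; case: (th s) => [[|[|[|?]]] ?].
  by rewrite /de beE gaE /class_sum e3 => ->; lia.
(* One of the truncated differences is 0, so [d] is the absolute difference. *)
pose d := (be x.1.1 - ga y.1.1 + (ga y.1.1 - be x.1.1))%N.
have wE : (2 * be x.1.1 ^ 2 + 2 * ga y.1.1 ^ 2 = de z.1.1 ^ 2 + d ^ 2)%N.
  rewrite deE /d; case: (leqP (be x.1.1) (ga y.1.1)) => le_bg.
    by rewrite (eqP le_bg) add0n -!mulnn; nia.
  rewrite (eqP (ltnW le_bg)) addn0 -!mulnn; nia.
have SE m : S m x y z = sgn x * tp * e m ^+ (d ^ 2).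
  rewrite /S -/tp -mulrA -[sgn x * _ * _]mulrA -exprD wE exprD.
  by rewrite [_ * e m ^+ (d ^ 2)]mulrC !mulrA mulfK ?expf_neq0 // mulrAC.
under eq_fun => m do rewrite SE.
have hashed_d : hashed om th = (d == 0%N).
  by rewrite /hashed -/v -/w -beE -gaE /d; apply/eqP/eqP; lia.
(* If [d = 0], the partition [th] is hashed, and isolation forces all three blocks to belong to
   it. *)
have [d0|d0] := eqVneq d 0%N.
  have hth : hashed om th by rewrite hashed_d d0.
  have tx : sval x.1.1 = th by apply: F_iso => //; exists 0.
  have ty : sval y.1.1 = th by apply: F_iso => //; exists 1.
  have tz : sval z.1.1 = th by apply: F_iso => //; exists 2.
  rewrite d0; under eq_fun => m do rewrite expr0 mulr1.
  rewrite tpE; first exact: tends_cst.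
    by apply: val_inj; rewrite /= tx tz.
  by apply: val_inj; rewrite /= ty tz.
(* If [d > 0], the entry tends to 0 and lies outside the direct sum: equal summands would make [th]
   a selected, hence hashed, coloring. *)
have -> : mm_sum C x y z = sgn x * tp * 0 ^+ (d ^ 2).
  rewrite expr0n expn_eq0 (negPf d0) /= mulr0; apply/eqP/negPn/negP => /mm_eq[exz eyz].
  have tz : sval z.1.1 = th.
    apply: (@coloring_class2 _ _ _ 1 2) => //; by rewrite -?eyz.
  have : hashed om th by rewrite -tz; case: (z.1.1) => t /=; rewrite inE => /and3P[].
  by rewrite hashed_d (negPf d0).
exact: (tendsM (@tends_cst _ (sgn x * tp)) (@tendsX _ _ _ (d ^ 2)%N (@tends_inv_nat R))).
Qed.

End Laser.

(** * Asymptotics *)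

Lemma binomial_third_rec (n : nat) :
  ((2 * n + 2) * (2 * n + 1) * 'C(3 * n.+1, n.+1) =
   3 * (3 * n + 2) * (3 * n + 1) * 'C(3 * n, n))%N.
Proof.
have := @bin_fact (3 * n) n; have := @bin_fact (3 * n.+1) n.+1.
rewrite (_ : 3 * n.+1 - n.+1 = (2 * n).+2)%N; last by lia.
rewrite (_ : 3 * n - n = 2 * n)%N; last by lia.
rewrite (_ : 3 * n.+1 = (3 * n).+3)%N; last by lia.
rewrite !factS => /(_ _)/wrap[|h1 /(_ _)/wrap[|h0]]; [by lia | by lia |].
have pos : (0 < n.+1 * (n`! * (2 * n)`!))%N by rewrite !muln_gt0 !fact_gt0.
apply/eqP; rewrite -(eqn_pmul2r pos); apply/eqP.
transitivity ((3 * n).+3 * ((3 * n).+2 * ((3 * n).+1 * (3 * n)`!)))%N.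
  by rewrite -h1; ring.
by rewrite -h0; ring.
Qed.

(** The ratio of consecutive binomials tends to 27/4 from below; the factor [2 n + 1] makes up for
    the deficit. *)
Lemma binomial_third_ge (n : nat) : (27 ^ n <= 4 ^ n * ((2 * n + 1) * 'C(3 * n, n)))%N.
Proof.
elim: n => [|n IH]; first by rewrite bin0.
have pos : (0 < (2 * n + 2) * (2 * n + 1))%N by rewrite muln_gt0; apply/andP; split; lia.
rewrite -(leq_pmul2l pos) [(27 ^ _)%N]expnS.
apply: (@leq_trans ((2 * n + 2) * (2 * n + 1) * (27 * (4 ^ n * ((2 * n + 1) * 'C(3 * n, n))))))%N.
  by rewrite !leq_mul2l IH !orbT.
rewrite [leqRHS](_ : _ = 4 ^ n.+1 * (2 * n.+1 + 1) *
  ((2 * n + 2) * (2 * n + 1) * 'C(3 * n.+1, n.+1)))%N; last by ring.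
rewrite binomial_third_rec expnS; set x := (4 ^ n)%N; set y := 'C(_, _).
rewrite [leqLHS](_ : _ = x * y * (27 * ((2 * n + 2) * (2 * n + 1) * (2 * n + 1))))%N; last by ring.
rewrite [leqRHS](_ : _ = x * y * (12 * ((2 * n + 3) * (3 * n + 2) * (3 * n + 1))))%N; last by ring.
by rewrite leq_mul2l; apply/orP; right; nia.
Qed.

Section Asymptotics.
Variable R : realType.

(** This removes all polynomial factors in the limit. With [n + 2] a square [m ^ 2],
    [ln (n + 2) = 2 ln m < 2 m], and a polynomial inequality in [m] remains. *)
Lemma le0_of_linear_le_log (u c d : R) : 0 <= d ->
  (forall n : nat, n.+1%:R * u <= c + d * ln n.+2%:R) -> u <= 0.
Proof.
move=> d0 h; rewrite leNgt; apply/negP => u0.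
pose b := (`|c| + 2 * d + u) / u.
pose m := (Num.truncn b).+2.
have mb : b <= m%:R.
  by apply: le_trans (ltW (truncnS_gt b)) _; rewrite ler_nat.
have [n nE] : exists n, n.+2 = (m ^ 2)%N.
  by exists (m ^ 2 - 2)%N; rewrite /m -mulnn; lia.
have := h n.
have -> : n.+1%:R = m%:R ^+ 2 - 1 :> R by rewrite -natrX -nE -[n.+2%:R]natr1 addrK.
have -> : n.+2%:R = m%:R ^+ 2 :> R by rewrite -natrX -nE.
rewrite lnXn ?ltr0n // mulr2n.
have ln_m : ln m%:R < m%:R :> R by rewrite ln_sublinear ?ltr0n.
have m2 : 2 <= m%:R :> R by rewrite ler_nat.
have : `|c| + 2 * d + u <= m%:R * u by rewrite -ler_pdivrMr.
have := ler_norm c; have := normr_ge0 c.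
move: `|c| m%:R (ln _) ln_m m2 => c' x l lx x2 c0 cc mu le1.
have p1 : d * l <= d * x by rewrite ler_wpM2l // ltW.
have p2 : x * (c' + 2 * d + u) <= x * (x * u) by rewrite ler_wpM2l //; lra.
have p3 : 2 * c' <= x * c' by rewrite ler_wpM2r.
have p4 : 2 * u <= x * u by rewrite ler_wpM2r // ltW.
by move: le1 p2; rewrite expr2 !mulrDr mulrBl mulrA; lra.
Qed.

End Asymptotics.

(** * The asymptotic sum inequality and the final bound *)

Section Main.
Variables (R : realType) (q : nat).
Hypothesis q_gt1 : (1 < q)%N.
Notation C := R[i].

(* Schoenhage's asymptotic sum inequality in the case of equal formats. *)
Lemma asymptotic_sum (F I : finType) (rho : nat)
    (S : nat -> F * I * I -> F * I * I -> F * I * I -> C) :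
  (0 < #|F|)%N -> (1 < #|I|)%N ->
  (forall m, rank_le rho (S m)) ->
  (forall x y z, tends (fun m => S m x y z) (mm_sum C x y z)) ->
  (0 < rho)%N /\ omega R * ln #|I|%:R + ln #|F|%:R <= ln rho%:R.
Proof.
move=> F0 I1 rkS lim.
have [D rkL] : exists D, forall L, rank_le (L.+1 ^ D * rho ^ L)
    (@mm_sum C {ffun 'I_L -> F} {ffun 'I_L -> I}).
  eexists => L; apply: mm_sum_pow.
  have := rank_le_limit_pow 'I_L rkS lim; rewrite card_ord; exact.
have gef L : (#|F| ^ L <= L.+1 ^ D * rho ^ L)%N.
  have := rank_mm_sum_ge _ (rkL L); rewrite !card_ffun card_ord => /(_ _)/wrap[|].
    by rewrite expn_gt0 (ltnW I1).
  by apply: leq_trans; rewrite leq_pmulr // !expn_gt0 (ltnW I1).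
have rho0 : (0 < rho)%N.
  by have := gef 1%N; rewrite !expn1; case: (rho) => //; rewrite muln0 leqNgt F0.
split=> //; rewrite -subr_le0.
apply: (@le0_of_linear_le_log _ _ (ln 2) D%:R) => // n; set L := n.+1.
pose f := (#|F| ^ L)%N; pose g := (L.+1 ^ D * rho ^ L)%N.
have f0 : (0 < f)%N by rewrite expn_gt0 F0.
(* Since [f <= g], this is at most [2 g / f], whence the constant [ln 2]. *)
pose a := (g %/ f).+1.
have cF : #|{ffun 'I_L -> F}| = f by rewrite card_ffun card_ord.
have cI : #|{ffun 'I_L -> I}| = (#|I| ^ L)%N by rewrite card_ffun card_ord.
have := omega_le (a := a) _ _ (rkL L); rewrite cF cI.
have I2 : (1 < #|I| ^ L)%N by rewrite -(expn0 #|I|) ltn_exp2l.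
have gaf : (g <= a * f)%N by rewrite ltnW // ltn_ceil.
move=> /(_ f0 I2 gaf).
have posI : 0 < ln #|I|%:R :> R by rewrite ln_gt0 // ltr1n.
rewrite natrX lnXn ?ltr0n ?(ltnW I1) // ler_pdivlMr ?pmulrn_lgt0 //.
have lna : ln a%:R + L%:R * ln #|F|%:R <= ln 2 + D%:R * ln L.+1%:R + L%:R * ln rho%:R :> R.
  rewrite !mulr_natl -!lnXn ?ltr0n // -!lnM ?posrE ?mulr_gt0 ?exprn_gt0 ?ltr0n //.
  rewrite ler_ln ?posrE ?mulr_gt0 ?exprn_gt0 ?ltr0n //.
  rewrite -!natrX -!natrM ler_nat -mulnA -/f -/g /a mulSn mul2n -addnn leq_add ?gef //.
  exact: leq_trunc_div.
by rewrite mulrnAr -mulr_natl; move: lna; nra.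
Qed.

(** The [3 (n + 1)]-th power of the [k]-th Kronecker power is the power of the original tensor over
    pairs of positions; its balanced colorings have classes of size [(n + 1) k]. *)
Lemma omega_bound_step (k r n : nat) :
  (0 < k)%N -> ~~ odd q ->
  limit_of_sums (kron_pow (skewcw C q) k) r ->
  let X : finType := {ffun 'I_k -> 'I_q.+1} in
  let rho := ((3 * n.+1).+1 ^ #|{: X * X * X}| * r ^ (3 * n.+1))%N in
  exists F0 : nat, [/\ ('C(3 * (n.+1 * k), n.+1 * k) <= 26 * (n.+1 * k) * F0)%N,
    (0 < F0)%N, (0 < rho)%N &
    omega R * (ln q%:R *+ (n.+1 * k)) + ln F0%:R <= ln rho%:R].
Proof.
move=> k0 q_even [S [rkS limS]] X rho.
pose P : finType := ('I_(3 * n.+1) * 'I_k)%type.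
have rkP : rank_le rho (tensor_pow (P := P) (@skew_coef C q)).
  have rk1 m : rank_le r (fun x y z : X => S m (x, y, z)).
    have [a [b [c ->]]] := rkS m; exists (fun m => a m), (fun m => b m), (fun m => c m) => x y z.
    by rewrite sum_ffunE; apply: eq_bigr => i _; rewrite !ffunE.
  have := rank_le_limit_pow 'I_(3 * n.+1) rk1 (fun x y z => limS (x, y, z)).
  rewrite card_ord -/rho.
  pose f (x : P -> 'I_q.+1) s : X := [ffun j => x (s, j)].
  have fE x s j : f x s j = x (s, j) by rewrite ffunE.
  move=> /(rank_le_map f f f (fun=> 1) (fun=> 1) (fun=> 1)) [a [b [c hT]]].
  exists a, b, c => x y z; rewrite -hT !mul1r /tensor_pow.
  transitivity (\prod_(s < 3 * n.+1) \prod_(j < k)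
    skew_coef C (x (s, j)) (y (s, j)) (z (s, j))).
    by rewrite pair_bigA; apply: eq_bigr; case.
  apply: eq_bigr => s _; rewrite ffunE; apply: eq_bigr => j _ /=.
  by rewrite !fE.
have [N NE] : exists N, N.+1 = (n.+1 * k)%N.
  by exists (n.+1 * k).-1; rewrite prednK // muln_gt0.
have cP : #|P| = (3 * N.+1)%N by rewrite card_prod !card_ord NE mulnA.
have [F [S' [F_large rkS' limS']]] := skew_laser q_even cP rkP.
exists #|F|; rewrite -NE; have F0 : (0 < #|F|)%N.
  rewrite lt0n; apply/eqP => F0; move: F_large; rewrite F0 muln0 leqn0 -leqn0 leqNgt bin_gt0.
  by rewrite leq_pmull.
have cI : #|{ffun 'I_N.+1 -> 'I_q}| = (q ^ N.+1)%N by rewrite card_ffun !card_ord.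
have [|rho0] := asymptotic_sum F0 _ rkS' limS'.
  by rewrite cI -(expn0 q) ltn_exp2l.
rewrite cI natrX lnXn ?ltr0n ?(ltnW q_gt1) //.
Qed.

End Main.

Theorem theorem2p5 (R : realType) (q : nat) (hq : (0 < q)%N)
    (hq2 : ~~ odd q) (k : nat) (hk : (0 < k)%N) :
  omega R <=
    logb q%:R
      (4 / 27 * (border_rank (kron_pow (skewcw R[i] q) k))%:R `^ (3 / k%:R)).
Proof.
have q1 : (1 < q)%N by case: q hq hq2 => [|[|]].
rewrite /border_rank; case: ex_minnP => r /asboolP lim _.
have step n := omega_bound_step q1 n hk hq2 lim.
pose X : finType := {ffun 'I_k -> 'I_q.+1}; pose d := #|{: X * X * X}|.
have r0 : (0 < r)%N.
  have [F0 [_ _ + _]] := step 0%N.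
  by rewrite muln_gt0 => /andP[_]; rewrite expn_gt0 orbF.
have lnq : 0 < ln q%:R :> R by rewrite ln_gt0 // ltr1n.
have kR : 0 < k%:R :> R by rewrite ltr0n.
(* The goal after taking logarithms and multiplying by [k]. *)
have key : k%:R * (omega R * ln q%:R) + k%:R * (ln 27 - ln 4) - 3 * ln r%:R <= 0.
  (* The coefficient [d + 2] collects the polynomial factor of the rank bound and the factors [26 N]
     and [2 N + 1]; the constant term collects what remains of them in [b1], [b2] and [b3]. *)
  apply: (@le0_of_linear_le_log _ _
    (d%:R * ln 3 + ln (26 * k%:R) + ln (2 * k%:R + 1)) (d%:R + 2)) => [|n].
    by rewrite addr_ge0.
  have [F0 [binF F0_gt0 rho0 ineq]] := step n.
  have [N NE] : exists N, N = (n.+1 * k)%N by exists (n.+1 * k)%N.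
  rewrite -NE in binF ineq.
  pose rho := ((3 * n.+1).+1 ^ d * r ^ (3 * n.+1))%N.
  have N0 : (0 < N)%N by rewrite NE muln_gt0.
  have ln_rho : ln rho%:R = d%:R * ln (3 * n.+1).+1%:R + (3 * n.+1)%:R * ln r%:R :> R.
    by rewrite /rho natrM !natrX lnM ?posrE ?exprn_gt0 ?ltr0n // !lnXn ?ltr0n // !mulr_natl.
  have lnF : N%:R * ln 27 <= N%:R * ln 4 + ln (2 * N + 1)%N%:R + ln (26 * N)%N%:R
      + ln F0%:R :> R.
    rewrite !mulr_natl -!lnXn ?ltr0n // -!lnM ?posrE ?mulr_gt0
      ?exprn_gt0 ?ltr0n ?muln_gt0 ?N0 ?addn1 //.
    rewrite ler_ln ?posrE ?mulr_gt0 ?exprn_gt0 ?ltr0n ?muln_gt0 ?N0 //.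
    rewrite -!natrX -!natrM ler_nat (leq_trans (binomial_third_ge N)) //.
    by rewrite -!mulnA leq_mul2l addn1 leq_mul2l mulnA binF !orbT.
  have lnD x (a b : R) : 0 < x -> 0 < a -> 0 < b -> x <= a * b -> ln x <= ln a + ln b.
    by move=> x0 a0 b0 le; rewrite -lnM // ler_ln // posrE mulr_gt0.
  have n2 : 0 < n.+2%:R :> R by rewrite ltr0n.
  have n1 : 0 < n.+1%:R :> R by rewrite ltr0n.
  have b1 : ln (3 * n.+1).+1%:R <= ln 3 + ln n.+2%:R :> R.
    by apply: lnD => //; rewrite ?ltr0n // -natrM ler_nat; lia.
  have b2 : ln (26 * N)%N%:R <= ln (26 * k%:R) + ln n.+2%:R :> R.
    apply: lnD => //; rewrite ?ltr0n ?muln_gt0 ?mulr_gt0 //.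
    by rewrite -!natrM ler_nat NE; nia.
  have b3 : ln (2 * N + 1)%N%:R <= ln (2 * k%:R + 1) + ln n.+2%:R :> R.
    apply: lnD => //; rewrite ?addr_gt0 ?mulr_gt0 ?ltr0n ?addn1 //.
    by rewrite -natrM natr1 -natrM ler_nat NE; nia.
  have b4 : d%:R * ln (3 * n.+1).+1%:R <= d%:R * (ln 3 + ln n.+2%:R) :> R.
    by rewrite ler_wpM2l.
  move: ineq lnF b2 b3 b4; rewrite -/rho ln_rho -[ln q%:R *+ _]mulr_natl.
  move: (ln (26 * N)%N%:R) (ln (2 * N + 1)%N%:R) (ln (3 * n.+1).+1%:R).
  move=> l1 l2 l3; rewrite NE !natrM.
  move: (omega R) (ln q%:R) (ln r%:R) (ln F0%:R) (ln n.+2%:R) (ln 27) (ln 4).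
  move: (ln 3) (ln (26 * k%:R)) (ln (2 * k%:R + 1)) => c1 c2 c3 w lq lr lF L2 c27 c4.
  move: n.+1%:R k%:R d%:R => m K D; lra.
rewrite /logb ler_pdivlMr // lnM ?posrE ?divr_gt0 ?powR_gt0 ?ltr0n //.
rewrite ln_powR ln_div ?posrE ?ltr0n //.
rewrite -(ler_pM2l kR) mulrDr; have -> : k%:R * (3 / k%:R * ln r%:R) = 3 * ln r%:R :> R.
  by field; rewrite gt_eqF.
by move: key; rewrite !mulrBr; lra.
Qed.
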